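(* Let $\alpha\in(0,1]$, $b_1,b_2>0$, $c\in(0,1)$ and let $f:[0,1]\to[0,1]$ be a map such that: (1) $0$ and $1$ are neutral fixed points: $f(0)=0$, $f(1)=1$, $f'(0)=f'(1)=1$; (2) $f|_{(0,c)}$ and $f|_{(c,1)}$ are $C^2$ diffeomorphisms onto $(0,1)$ that admit $C^2$ extensions to the closed intervals $[0,c]$ and $[c,1]$ respectively, with image $[0,1]$; (3) $f'(x)>1$ for all $x\in(0,1)$ (at $x=c$: for both one-sided derivatives of the extensions in (2)), $f$ is convex on a neighbourhood of $0$ and $f$ is concave on a neighbourhood of $1$; (4) $f(x)-x\sim b_1x^{1+1/\alpha}$ as $x\to0$ and $x-f(x)\sim b_2(1-x)^{1+1/\alpha}$ as $x\to1$. Then there exists $\bar p\in(0,1)$ such that, with $\nu_{\bar p}=\bar p\,\delta_0+(1-\bar p)\,\delta_1$, $$\lim_{n\to\infty} f^n_*\lambda=\nu_{\bar p}$$ for every probability measure $\lambda$ on $[0,1]$ that is absolutely continuous with respect to Lebesgue measure.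
   Context: Convergence of measures is in the weak-$*$ topology; $f^n_*\lambda$ is the pushforward of $\lambda$ under $f^n$; $\delta_x$ is the Dirac mass at $x$. $a(x)\sim b(x)$ means $a(x)/b(x)\to1$. The number $\bar p$ does not depend on $\lambda$. *)

(* Defs.v *)
From mathcomp Require Import all_boot all_order all_algebra.
From mathcomp Require Import all_classical all_reals all_analysis.

Set Implicit Arguments.
Unset Strict Implicit.
Unset Printing Implicit Defensive.

Import Order.TTheory GRing.Theory Num.Theory.
Import numFieldNormedType.Exports.

Local Open Scope classical_set_scope.
Local Open Scope ring_scope.

(* Derivatives relative to an interval [D]: the difference quotient is taken
   over points of [D] only, so that at an end point of [D] these are the
   one-sided derivatives and the values of [g] outside [D] are irrelevant. *)
Definition derivable_within (R : realType) (D : set R) (g : R -> R) (x : R) :=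
  cvg ((fun y => (g y - g x) / (y - x)) @ within D x^').

Definition derive_within (R : realType) (D : set R) (g : R -> R) (x : R) : R :=
  lim ((fun y => (g y - g x) / (y - x)) @ within D x^').

Definition C2_on (R : realType) (D : set R) (g : R -> R) :=
  [/\ {in D, forall x, derivable_within D g x},
      {in D, forall x, derivable_within D (derive_within D g) x}
    & {within D, continuous (derive_within D (derive_within D g))}].

Definition C2_diffeo (R : realType) (A B : set R) (g : R -> R) :=
  [/\ set_bij A B g, C2_on A g
    & exists2 h : R -> R, {in A, cancel g h} & C2_on B h].

(* A probability measure on [0, 1] is represented by one on the line giving
   mass 1 to [0, 1], and a map of [0, 1] to itself by a total function whose
   values outside [0, 1] are arbitrary.  Hence the restriction before the push
   forward: the result is A |-> lambda ([0, 1] `&` g @^-1` A). *)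
Definition pushforward01 (R : realType)
    (lambda : set (measurableTypeR R) -> \bar R) (g : R -> R) :
    set (measurableTypeR R) -> \bar R :=
  pushforward (mrestr lambda (measurable_itv `[0, 1]))
    (g : measurableTypeR R -> measurableTypeR R).

Definition weak_star_cvg01 (R : realType)
    (mu : nat -> set (measurableTypeR R) -> \bar R)
    (nu : set (measurableTypeR R) -> \bar R) :=
  forall phi : R -> R, {within `[0, 1], continuous phi} ->
    (\int[mu n]_(x in `[0%R, 1%R]) (phi x)%:E)%E @[n --> \oo]
      --> (\int[nu]_(x in `[0%R, 1%R]) (phi x)%:E)%E.

Definition two_point_mass (R : realType) (p : R) :
    set (measurableTypeR R) -> \bar R :=
  fun A => (p%:E * \d_(0%R : measurableTypeR R) A
            + (1 - p)%:E * \d_(1%R : measurableTypeR R) A)%E.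

(* Main.v *)
Require Import Defs.
From mathcomp Require Import all_boot all_order all_algebra.
From mathcomp Require Import all_classical all_reals all_analysis.
From mathcomp Require Import ring lra zify.

Set Implicit Arguments.
Unset Strict Implicit.
Unset Printing Implicit Defensive.

Import Order.TTheory GRing.Theory Num.Theory.
Import numFieldNormedType.Exports.

Local Open Scope classical_set_scope.
Local Open Scope ring_scope.

(** The map has two inverse branches, [l = f_inv false] onto [0, c] and
    [r = f_inv true] onto [c, 1].  If [F n] is the distribution function of the
    image of a measure on [0, 1] under the [n]-th iterate, then
    [F n.+1 x = F n (l x) + F n (r x) - F n c], because the preimage of [0, x] is
    [0, l x] together with ]c, r x].  An absolutely continuous measure is close in
    total variation to one with a positive continuous density, and taking images
    does not increase this distance ([law_cvg]).  So it is enough to prove, for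
    such densities, that [F n x] tends to a fixed proportion of the total mass for
    every [x] in (0, 1) ([cumul_cvg]): all the mass goes to the end points, and
    [weak_lim] concludes.

    The iterates of the inverse branches have bounded distortion away from 0 and
    1: the images of a fundamental domain of [l] are disjoint, so their lengths
    have a bounded sum ([sum_der_iter_bound]), and each change of branch contracts
    by a definite factor ([orbdist_bound]).  Hence the densities [rho n] satisfy
    Harnack inequalities and are equicontinuous on compact intervals of (0, 1),
    uniformly in [n] ([rho_harnack], [rho_equicont]).

    The density at [c] tends to 0 ([rho_c_cvg0]).  The integral of the parallel
    sum of [rho n] and [rho n.+1] is bounded and nondecreasing in [n]
    ([parsum_entropy]), and its increment dominates the squared difference of the
    values of [rho n.+1 / rho n] at the two preimages of a point
    ([parsum_gapE]).  These ratios are therefore asymptotically the same at all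
    points and slowly varying in time, as long as [rho n c] is not small
    ([ratio_space], [ratio_time]).  If the upper limit [U] of [rho n c] were
    positive, [rho n c] would stay above [U / 4] during arbitrarily long periods.
    But mass enters [0, c] through the intervals from [c] to [c + gap_right i],
    where [i] counts the steps elapsed since the entrance, and the sum of the
    [gap_right i] is infinite because [alpha <= 1] ([gap_right_sum_dvg]): the mass
    entered during such a period would exceed the total mass.

    Finally, decompose the mass on each side of [c] according to its last entrance
    there.  The entrances from both sides that are [i] steps old involve intervals
    of lengths [gap_right i] and [gap_left i] at [c] at the same time, so by
    equicontinuity they are nearly in the proportion of the lengths, and those
    that are recent are negligible since [rho n c] tends to 0.  The two masses are
    thus asymptotically in the proportion [kap], the limit of
    [gap_right i / gap_left i] ([cumul_balance]).  This limit is found from the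
    asymptotics of [f] at 0 and 1: in the variable [y `^ (- alpha^-1)] the orbit of
    [c] under [l] moves by almost constant steps ([neutral_orbit_growth]), and
    likewise for [r] ([gap_ratio_cvg]). *)

(** * Calculus on segments *)

Section calculus.
Variable R : realType.
Implicit Types (f df q : R -> R) (a b x y : R).

Lemma mvt f df a b : a < b ->
  (forall x, a < x < b -> is_derive x 1 f (df x)) ->
  (forall x, a <= x <= b -> {for x, continuous f}) ->
  exists2 x, a < x < b & f b - f a = df x * (b - a).
Proof.
move=> ab dfE cf.
have dfE' x : x \in `]a, b[%R -> is_derive x 1 f (df x).
  by rewrite in_itv /=; exact: dfE.
have cf' : {within `[a, b], continuous f}.
  by apply: continuous_in_subspaceT => x; rewrite inE /= in_itv /=; exact: cf.
have [x xab ->] := MVT ab dfE' cf'.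
by exists x => //; rewrite in_itv in xab.
Qed.

Lemma is_derive_continuous f x d : is_derive x 1 f d -> {for x, continuous f}.
Proof. by case=> dfx _; exact/differentiable_continuous/derivable1_diffP. Qed.

Lemma segment_max f a b : a <= b -> (forall x, {for x, continuous f}) ->
  exists2 x, a <= x <= b & forall y, a <= y <= b -> f y <= f x.
Proof.
move=> ab cf; have [x xab fx] := @EVT_max R f a b ab (continuous_subspaceT cf).
exists x; first by rewrite in_itv in xab.
by move=> y yab; apply: fx; rewrite in_itv.
Qed.

Lemma segment_min f a b : a <= b -> (forall x, {for x, continuous f}) ->
  exists2 x, a <= x <= b & forall y, a <= y <= b -> f x <= f y.
Proof.
move=> ab cf; have [x xab fx] := @EVT_min R f a b ab (continuous_subspaceT cf).
exists x; first by rewrite in_itv in xab.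
by move=> y yab; apply: fx; rewrite in_itv.
Qed.

(** The base point -1 makes the fundamental theorem of calculus available at the
    end points of [0, 1] too. *)
Lemma primitive q : (forall x, {for x, continuous q}) ->
  exists2 G : R -> R, G 0 = 0 & forall x, -1 < x < 2 -> is_derive x 1 G (q x).
Proof.
move=> cq; pose F y : R := \int[lebesgue_measure]_(t in `[-1, y]) q t.
have intq : lebesgue_measure.-integrable `[-1, 2] (EFin \o q).
  apply: continuous_compact_integrable; first exact: segment_compact.
  exact: continuous_subspaceT.
exists (fun y => F y - F 0); first by rewrite subrr.
move=> x /andP[x1 x2].
have [dF F'] := @continuous_FTC1_closed R q (-1) x 2 x2 intq x1 (cq x).
have FE : is_derive x 1 F (q x) by rewrite -F' derive1E; exact: DeriveDef.
by rewrite -[q x]subr0; apply: is_deriveB.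
Qed.

Lemma segment_unif_cont q a b e : (forall x, {for x, continuous q}) -> 0 < e ->
  exists2 d, 0 < d & forall x y, a <= x <= b -> `|x - y| < d -> `|q x - q y| < e.
Proof.
move=> cq e0.
have /compact_near_coveringP cK := @segment_compact R a b.
have := cK _ (0 : R)^'+ (fun d x => forall y, `|x - y| < d -> `|q x - q y| < e) _.
case=> [x _|d /= d0 H].
  have e2 : 0 < e / 2 by lra.
  have /cvgrPdist_lt/(_ _ e2)[d /= d0 H] := cq x.
  have d2 : 0 < d / 2 by lra.
  exists (ball x (d / 2), [set t | 0 < t < d / 2]).
    split; first exact: nbhsx_ballx.
    exists (d / 2) => // t /=; rewrite sub0r normrN => td t0.
    by rewrite t0 (le_lt_trans (ler_norm _) td).
  move=> [z t] /= [zx tI] y zy; rewrite -ball_normE /= in zx.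
  rewrite (_ : q z - q y = (q x - q y) - (q x - q z)); last by lra.
  apply: le_lt_trans (ler_normB _ _) _.
  have h1 := H z; have h2 := H y; rewrite /= in h1 h2.
  have : `|x - y| < d.
    by rewrite (_ : x - y = (x - z) + (z - y)); [have := ler_normD (x - z) (z - y); lra|lra].
  have : `|x - z| < d by lra.
  by move=> /h1 ? /h2 ?; lra.
exists (d / 2); first by lra.
have d2 : `|0 - d / 2| < d by rewrite sub0r normrN ger0_norm; lra.
have d20 : 0 < d / 2 by lra.
by move=> x y xK; apply: (H _ d2 d20 x); rewrite /= in_itv.
Qed.

Lemma lipschitz_continuous (h : R -> R) K : 0 <= K ->
  (forall x y, `|h x - h y| <= K * `|x - y|) -> forall x, {for x, continuous h}.
Proof.
move=> K0 hK x; apply/cvgrPdist_lt => e e0.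
have K1 : 0 < K + 1 by lra.
exists (e / (K + 1)); first by rewrite /= divr_gt0.
move=> y /=; rewrite ltr_pdivlMr// => h1; apply: le_lt_trans (hK x y) _.
by have := normr_ge0 (x - y); lra.
Qed.

Lemma increments_small (H : nat -> R) M : (forall n, H n <= M) ->
  (forall n, H n <= H n.+1) ->
  forall e, 0 < e -> exists N, forall n, (N <= n)%N -> H n.+1 - H n <= e.
Proof.
move=> HM Hi e e0.
have cvH : cvgn H.
  apply: nondecreasing_is_cvgn; first exact/nondecreasing_seqP.
  by exists M => _ [n _ <-].
have e2 : 0 < e / 2 by lra.
have /cvgrPdist_lt/(_ _ e2)[N _ HN] := cvH.
exists N => n Nn; have := HN n Nn; have := HN n.+1 (leqW Nn).
by rewrite /= => /ltr_normlP[? ?] /ltr_normlP[? ?]; lra.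
Qed.

Lemma cvg_seq_le (u : nat -> R) L e : u @ \oo --> L -> 0 < e ->
  exists N, forall n, (N <= n)%N -> `|u n - L| <= e.
Proof.
move=> /cvgrPdist_le/(_ e) H /H[N _ HN]; exists N => n Nn.
by rewrite distrC; exact: HN.
Qed.

Lemma sum_initial_le I (e : R) n : 0 <= e ->
  \sum_(i < n) (if (i < I)%N then e else 0) <= I%:R * e.
Proof.
move=> e0; apply: le_trans (_ : (minn n I)%:R * e <= _); last first.
  by rewrite ler_wpM2r// ler_nat geq_minr.
elim: n => [|m IH]; first by rewrite big_ord0 min0n mul0r.
rewrite big_ord_recr /=; case: ltnP => mI.
  by move: IH; rewrite (minn_idPl (ltnW mI)) (minn_idPl mI) -(natr1 m); lra.
rewrite addr0; apply: le_trans IH _.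
by rewrite (minn_idPr mI) (minn_idPr (leqW mI)).
Qed.

Lemma leq_add4_split (a1 a2 a3 k n : nat) : (a1 + a2 + a3 + k <= n)%N ->
  [/\ (a1 <= n)%N, (a2 <= n)%N, (a3 + k <= n)%N & (k <= n)%N].
Proof. by split; lia. Qed.

Lemma leq_subr_addl (a1 k i n : nat) : (a1 + k <= n)%N -> (i <= k)%N -> (a1 <= n - i)%N.
Proof. lia. Qed.

Lemma itv01W x : 0 < x < 1 -> 0 <= x <= 1.
Proof. by move=> /andP[/ltW -> /ltW ->]. Qed.

End calculus.

(** * Inverse branches and bounded distortion *)

(** The inverse branches of an expanding map of [0, 1] with two increasing full
    branches meeting at [c], and their derivatives.  Continuity is required on
    the whole line, to avoid one-sided limits at 0 and 1. *)
Record inverse_branches (R : realType) (c D : R) (g dg : bool -> R -> R) : Prop := {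
  ib_c : 0 < c < 1;
  ib_cont : forall b x, {for x, continuous (g b)};
  ib_der_cont : forall b x, {for x, continuous (dg b)};
  ib_der : forall b (x : R), 0 < x < 1 -> is_derive x 1 (g b) (dg b x);
  ib_der_gt0 : forall b x, 0 < dg b x;
  ib_der_lt1 : forall b x, 0 < x < 1 -> dg b x < 1;
  ib_0 : forall b, g b 0 = if b then c else 0;
  ib_1 : forall b, g b 1 = if b then 1 else c;
  ib_D_ge0 : 0 <= D;
  ib_distortion : forall b x y, 0 < x < 1 -> 0 < y < 1 ->
    dg b x <= expR (D * `|g b x - g b y|) * dg b y }.

Section branches.
Variables (R : realType) (c D : R) (g dg : bool -> R -> R).
Implicit Types (x y : R) (b : bool) (w : seq bool).

Hypothesis gB : inverse_branches c D g dg.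

Let c01 := ib_c gB.
Let g_cont := ib_cont gB.
Let dg_cont := ib_der_cont gB.
Let g_der := ib_der gB.
Let dg_gt0 := ib_der_gt0 gB.
Let dg_lt1 := ib_der_lt1 gB.
Let g_0 := ib_0 gB.
Let g_1 := ib_1 gB.
Let D_ge0 := ib_D_ge0 gB.
Let g_distortion := ib_distortion gB.

Lemma dg01 b x : 0 < x < 1 -> 0 < dg b x < 1.
Proof. by move=> xI; rewrite dg_gt0 dg_lt1. Qed.

Lemma g_mvt b x y : 0 <= x -> x < y -> y <= 1 ->
  exists2 z, x < z < y & g b y - g b x = dg b z * (y - x).
Proof.
move=> x0 xy y1; apply: mvt => // z /andP[xz zy].
by apply: g_der; rewrite (le_lt_trans x0 xz) (lt_le_trans zy y1).
Qed.

Lemma g_incr b x y : 0 <= x -> x < y -> y <= 1 -> g b x < g b y.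
Proof.
move=> x0 xy y1; have [z /andP[xz zy] e] := g_mvt b x0 xy y1.
have /andP[d0 _] : 0 < dg b z < 1 by apply: dg01; lra.
by rewrite -subr_gt0 e mulr_gt0// subr_gt0.
Qed.

Lemma g_le b x y : 0 <= x -> x <= y -> y <= 1 -> g b x <= g b y.
Proof.
by move=> x0; rewrite le_eqVlt => /predU1P[->//|xy] y1; exact/ltW/g_incr.
Qed.

Lemma g_contr b x y : 0 <= x -> x < y -> y <= 1 -> g b y - g b x < y - x.
Proof.
move=> x0 xy y1; have [z /andP[xz zy] ->] := g_mvt b x0 xy y1.
have /andP[_ d1] : 0 < dg b z < 1 by apply: dg01; lra.
by rewrite gtr_pMl// subr_gt0.
Qed.

Lemma g_dist b x y : 0 <= x <= 1 -> 0 <= y <= 1 -> `|g b x - g b y| <= `|x - y|.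
Proof.
wlog xy : x y / x <= y.
  move=> H xI yI; case/orP: (le_total x y) => xy; first exact: H.
  by rewrite distrC (distrC x); exact: H.
move=> /andP[x0 _] /andP[_ y1].
rewrite distrC (distrC x) !ger0_norm ?subr_ge0 ?g_le//.
move: xy; rewrite le_eqVlt => /predU1P[->|xy]; first by rewrite !subrr.
exact/ltW/g_contr.
Qed.

Lemma g01 b x : 0 < x < 1 -> 0 < g b x < 1.
Proof.
move=> /andP[x0 x1]; have /andP[c0 c1] := c01.
have := g_incr b (lexx 0) x0 (ltW x1); have := g_incr b (ltW x0) x1 (lexx 1).
rewrite g_0 g_1; case: b; lra.
Qed.

Lemma g01w b x : 0 <= x <= 1 -> 0 <= g b x <= 1.
Proof.
move=> /andP[x0 x1]; have /andP[c0 c1] := c01.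
have := g_le b (lexx 0) x0 x1; have := g_le b x0 x1 (lexx 1).
rewrite g_0 g_1; case: b; lra.
Qed.

Lemma gl_ltc x : 0 < x < 1 -> g false x < c.
Proof.
by move=> /andP[x0 x1]; have := g_incr false (ltW x0) x1 (lexx 1); rewrite g_1.
Qed.

Lemma gr_gtc x : 0 < x < 1 -> c < g true x.
Proof.
by move=> /andP[x0 x1]; have := g_incr true (lexx 0) x0 (ltW x1); rewrite g_0.
Qed.

(** The left branch moves points to the left, the right one to the right; the
    sign lets the two share the proofs on displacements. *)
Lemma g_sign b x : 0 < x < 1 -> 0 < (-1) ^+ b * (x - g b x).
Proof.
move=> /andP[x0 x1]; case: b; rewrite ?expr1 ?expr0.
  by have := g_contr true (ltW x0) x1 (lexx 1); rewrite g_1; lra.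
by have := g_contr false (lexx 0) x0 (ltW x1); rewrite g_0; lra.
Qed.

Lemma g_normE b x : 0 < x < 1 -> `|x - g b x| = (-1) ^+ b * (x - g b x).
Proof.
move=> /(g_sign b) s; rewrite -[in RHS](gtr0_norm s).
by rewrite normrM normrX normrN1 expr1n mul1r.
Qed.

Lemma iter_g01 b k x : 0 < x < 1 -> 0 < iter k (g b) x < 1.
Proof. by move=> xI; elim: k => [//|k IH] /=; exact: g01. Qed.

Lemma iter_g_cont b k x : {for x, continuous (iter k (g b))}.
Proof.
by elim: k x => [|k IH] x; [exact: cvg_id | exact: continuous_comp].
Qed.

Definition der_iter b k x := \prod_(i < k) dg b (iter i (g b) x).

Lemma iter_is_derive b k x : 0 < x < 1 -> is_derive x 1 (iter k (g b)) (der_iter b k x).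
Proof.
move=> xI; elim: k => [|k IH]; first by rewrite /der_iter big_ord0; exact: is_derive_id.
rewrite /der_iter big_ord_recr /= mulrC.
rewrite [iter _ _](_ : _ = g b \o iter k (g b)); last by apply/funext.
have ? := g_der b (iter_g01 b k xI); exact: is_derive1_comp.
Qed.

Lemma der_iter_gt0 b k x : 0 < x < 1 -> 0 < der_iter b k x.
Proof.
by move=> xI; apply: prodr_gt0 => i _; case/andP: (dg01 b (iter_g01 b i xI)).
Qed.

Lemma der_iter_distortion b k x y : 0 < x < 1 -> 0 < y < 1 ->
  der_iter b k x <= expR (D * \sum_(i < k) `|iter i.+1 (g b) x - iter i.+1 (g b) y|)
               * der_iter b k y.
Proof.
move=> xI yI; elim: k => [|k IH].
  by rewrite /der_iter !big_ord0 mulr0 expR0 mulr1.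
rewrite [in leRHS]big_ord_recr mulrDr expRD /der_iter !big_ord_recr /= mulrACA.
apply: ler_pM => //; [exact/ltW/der_iter_gt0 | | by apply: g_distortion; exact: iter_g01].
by case/andP: (dg01 b (iter_g01 b k xI)) => /ltW.
Qed.

Lemma sum_displacement b n x : 0 < x < 1 ->
  \sum_(k < n) `|iter k (g b) x - iter k.+1 (g b) x| <= 1.
Proof.
move=> xI; rewrite (eq_bigr (fun k : 'I_n =>
  (-1) ^+ b * (iter k (g b) x - iter k.+1 (g b) x))); last first.
  by move=> k _; rewrite -g_normE//; exact: iter_g01.
rewrite -mulr_sumr -(big_mkord xpredT (fun k => iter k (g b) x - iter k.+1 (g b) x)).
rewrite (eq_bigr (fun k => - (iter k.+1 (g b) x - iter k (g b) x))); last first.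
  by move=> k _; rewrite opprB.
rewrite sumrN telescope_sumr//=.
have := iter_g01 b n xI; move: xI; case: b; rewrite ?expr1 ?expr0; lra.
Qed.

Lemma iter_le b k x y : 0 < x < 1 -> 0 < y < 1 -> x <= y ->
  iter k (g b) x <= iter k (g b) y.
Proof.
move=> xI yI xy; elim: k => //= k IH.
by have := iter_g01 b k xI; have := iter_g01 b k yI => ? ?; apply: g_le => //; lra.
Qed.

(** The fundamental domain between [g b x] and [x] is carried by the iterates of
    [g b] to pairwise disjoint intervals, whose total length is at most 1; this
    bounds the distortion of all iterates on that domain, so that the derivative
    at [x] of the [k]-th iterate is comparable to the length of the [k]-th
    image.  The bound is therefore again a sum of lengths of disjoint
    intervals. *)
Lemma sum_der_iter_bound b n x : 0 < x < 1 ->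
  (\sum_(k < n) der_iter b k x) * `|x - g b x| <= expR D.
Proof.
move=> xI; have gxI := g01 b xI.
suff H k : der_iter b k x * `|x - g b x| <=
    expR D * `|iter k (g b) x - iter k.+1 (g b) x|.
  rewrite mulr_suml; apply: le_trans (ler_sum _ (fun (k : 'I_n) _ => H k)) _.
  rewrite -mulr_sumr.
  by rewrite ler_piMr ?expR_ge0 ?sum_displacement.
have [z [zI zd ->]] : exists z, [/\ 0 < z < 1,
   forall j, `|iter j (g b) x - iter j (g b) z| <= `|iter j (g b) x - iter j.+1 (g b) x| &
   `|iter k (g b) x - iter k.+1 (g b) x| = der_iter b k z * `|x - g b x|].
  have key u v : 0 < u < 1 -> 0 < v < 1 -> u < v -> exists2 z, u < z < v &
     `|iter k (g b) v - iter k (g b) u| = der_iter b k z * `|v - u|.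
    move=> /andP[u0 _] /andP[_ v1] uv.
    have [z zuv e] : exists2 z, u < z < v &
        iter k (g b) v - iter k (g b) u = der_iter b k z * (v - u).
      apply: mvt => // [t|t _]; last exact: iter_g_cont.
      by move=> /andP[ut tv]; apply: iter_is_derive; lra.
    exists z => //; rewrite e normrM gtr0_norm// der_iter_gt0//; lra.
  have := g_sign b xI; have := iter_g01 b; rewrite !iterSr => _ s.
  have [gx|gx|gx] := ltgtP (g b x) x; last by move: s; rewrite gx subrr mulr0 ltxx.
    have [z /andP[z1 z2] e] := key _ _ gxI xI gx.
    have zI : 0 < z < 1 by lra.
    exists z; split => // j; rewrite iterSr.
    have := iter_le b j gxI zI (ltW z1); have := iter_le b j zI xI (ltW z2).
    by move=> ? ?; rewrite !ger0_norm; lra.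
  have [z /andP[z1 z2] e] := key _ _ xI gxI gx.
  have zI : 0 < z < 1 by lra.
  exists z; split => //; last by rewrite distrC (distrC x).
  move=> j; rewrite iterSr.
  have := iter_le b j zI gxI (ltW z2); have := iter_le b j xI zI (ltW z1).
  by move=> ? ?; rewrite !ler0_norm; lra.
rewrite mulrA ler_wpM2r//.
apply: le_trans (der_iter_distortion b k xI zI) _.
rewrite ler_wpM2r ?(ltW (der_iter_gt0 _ _ _))// ler_expR ler_piMr//.
apply: le_trans (sum_displacement b k (g01 b xI)).
by apply: ler_sum => i _; rewrite -!iterSr.
Qed.

(** The displacement is bounded below on a compact interval of (0, 1), so that
    [sum_der_iter_bound] bounds the derivative of the sum of the iterates there. *)
Lemma sum_iter_lip b p q : 0 < p -> p <= q -> q < 1 ->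
  exists2 B, 0 <= B & forall n x y, p <= x <= q -> p <= y <= q ->
    \sum_(k < n) `|iter k (g b) x - iter k (g b) y| <= B * `|x - y|.
Proof.
move=> p0 pq q1.
have [|m mK mmin] := @segment_min R (fun x => `|x - g b x|) p q pq.
  move=> x; apply: (@continuous_comp _ _ _ (fun t => t - g b t) Num.norm).
    by apply: continuousB; [exact: cvg_id|exact: g_cont].
  exact: norm_continuous.
have mI : 0 < m < 1 by lra.
have m0 : 0 < `|m - g b m|.
  by rewrite normr_gt0; apply/eqP => e; have := g_sign b mI; rewrite e mulr0 ltxx.
exists (expR D / `|m - g b m|); first by rewrite divr_ge0 ?expR_ge0.
move=> n x y; wlog xy : x y / x < y.
  move=> H xK yK; case: (ltgtP x y) => xy; first exact: H.
    rewrite (distrC x); under eq_bigr do rewrite distrC; exact: H.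
  by rewrite xy subrr normr0 mulr0 big1// => k _; rewrite subrr normr0.
move=> xK yK.
have xI : 0 < x < 1 by lra.
have yI : 0 < y < 1 by lra.
have [z zxy e] : exists2 z, x < z < y &
    (\sum_(k < n) iter k (g b)) y - (\sum_(k < n) iter k (g b)) x
     = (\sum_(k < n) der_iter b k z) * (y - x).
  have dE t : x <= t <= y ->
      is_derive t 1 (\sum_(k < n) iter k (g b)) (\sum_(k < n) der_iter b k t).
    move=> txy; have tI : 0 < t < 1 by lra.
    by apply: is_derive_sum => k; exact: iter_is_derive.
  apply: mvt => // [t txy|t txy]; first by apply: dE; lra.
  exact: is_derive_continuous (dE t txy).
have zI : 0 < z < 1 by lra.
rewrite [`|x - y|]distrC [`|y - x|]gtr0_norm ?subr_gt0//.
have -> : \sum_(k < n) `|iter k (g b) x - iter k (g b) y| =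
    (\sum_(k < n) iter k (g b)) y - (\sum_(k < n) iter k (g b)) x.
  rewrite !fct_sumE -sumrB; apply: eq_bigr => k _.
  by rewrite distrC ger0_norm// subr_ge0 iter_le// ltW.
rewrite e ler_wpM2r ?subr_ge0 ?(ltW xy)//.
rewrite ler_pdivlMr//; apply: le_trans (sum_der_iter_bound b n zI).
apply: ler_wpM2l; first by apply: sumr_ge0 => k _; exact/ltW/der_iter_gt0.
by apply: mmin; lra.
Qed.

Lemma g_contraction b p q : 0 < p -> p <= q -> q < 1 ->
  exists2 t, 0 <= t < 1 & forall x y, p <= x <= q -> p <= y <= q ->
    `|g b x - g b y| <= t * `|x - y|.
Proof.
move=> p0 pq q1.
have [m mK mmax] := @segment_max R (dg b) p q pq (@dg_cont b).
have mI : 0 < m < 1 by lra.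
exists (dg b m) => [|x y]; first by have := dg01 b mI; lra.
wlog xy : x y / x < y.
  move=> H xK yK; case: (ltgtP x y) => xy; first exact: H.
    by rewrite [`|x - y|]distrC [leLHS]distrC; exact: H.
  by rewrite xy !subrr normr0 mulr0.
move=> xK yK; have x0 : 0 <= x by lra. have y1 : y <= 1 by lra.
have [z /andP[xz zy] e] := g_mvt b x0 xy y1.
have zI : 0 < z < 1 by lra. have := dg01 b zI => dz.
rewrite distrC e (distrC x) normrM; apply: ler_wpM2r => //.
by rewrite ger0_norm; [apply: mmax|]; lra.
Qed.

(** This controls the distortion, between [x] and [y], of the composition of the
    branches listed in [w]. *)
Fixpoint orbdist w x y : R :=
  if w is b :: w' then `|g b x - g b y| + orbdist w' (g b x) (g b y) else 0.

(** A word is a succession of runs of the same letter.  Each run is summable by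
    [sum_iter_lip]; at each change of letter both points are back in
    [[g false c, g true c]], having been brought closer by a fixed factor, so
    the contributions of the runs form a geometric series. *)
Lemma orbdist_bound p q : 0 < p -> p <= g false c -> g true c <= q -> q < 1 ->
  exists2 B, 0 <= B & forall w x y, p <= x <= q -> p <= y <= q ->
    orbdist w x y <= B * `|x - y|.
Proof.
move=> p0 pl rq q1; have /andP[c0 c1] := c01.
have lc := gl_ltc c01; have rc := gr_gtc c01.
have pq : p <= q by lra.
have [B1 B10 HB1] := sum_iter_lip false p0 pq q1.
have [B2 B20 HB2] := sum_iter_lip true p0 pq q1.
have [t1 t1I Ht1] := g_contraction false p0 pq q1.
have [t2 t2I Ht2] := g_contraction true p0 pq q1.
pose B := B1 + B2; pose t := Num.max t1 t2.
have tI : 0 <= t < 1 by rewrite /t; case: (ltP t1 t2); lra.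
have HB b n x y : p <= x <= q -> p <= y <= q ->
    \sum_(k < n) `|iter k (g b) x - iter k (g b) y| <= B * `|x - y|.
  move=> xK yK; case: b; [apply: le_trans (HB2 n x y xK yK) _|
    apply: le_trans (HB1 n x y xK yK) _]; rewrite ler_wpM2r// /B; lra.
have HB' b n x y : p <= x <= q -> p <= y <= q ->
    `|x - y| + \sum_(k < n) `|iter k.+1 (g b) x - iter k.+1 (g b) y| <= B * `|x - y|.
  by move=> xK yK; have := HB b n.+1 x y xK yK; rewrite big_ord_recl.
have Ht b x y : p <= x <= q -> p <= y <= q -> `|g b x - g b y| <= t * `|x - y|.
  move=> xK yK; case: b; [apply: le_trans (Ht2 x y xK yK) _|
    apply: le_trans (Ht1 x y xK yK) _]; rewrite ler_wpM2r// /t le_max lexx ?orbT//.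
have I x : p <= x <= q -> 0 < x < 1 by lra.
have Idist b m x y : 0 < x < 1 -> 0 < y < 1 ->
    `|iter m (g b) x - iter m (g b) y| <= `|x - y|.
  move=> xI yI; elim: m => //= m IH; apply: le_trans IH.
  have := iter_g01 b m xI; have := iter_g01 b m yI => ? ?.
  by apply: g_dist; exact: itv01W.
have B0 : 0 <= B by rewrite addr_ge0.
(* Relative to [`|x - y|], a run contributes at most [B], the letter that follows
   it [t], and what comes after [C * t] by induction. *)
pose C := (B + 1) / (1 - t).
have t0 : 0 < 1 - t by lra.
have C0 : 0 <= C by rewrite divr_ge0; lra.
have CE : B + t + C * t <= C.
  suff : C * (1 - t) = B + 1 by lra.
  by rewrite /C -mulrA mulVf ?mulr1// gt_eqF.
have back b b' m x : p <= x <= q -> b != b' -> p <= g b' (iter m.+1 (g b) x) <= q.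
  move=> /I xI bb'; have uI := iter_g01 b m xI; rewrite iterS.
  move: (iter m _ x) uI => u uI {x xI}; have vI := g01 b uI.
  case: b b' bb' vI => [] [] //= _ vI.
    have := gl_ltc vI; have := gr_gtc uI => cu ?.
    have := g_incr false (ltW c0) cu; have := g01 false vI; lra.
  have := gr_gtc vI; have := gl_ltc uI => uc ?.
  have u0 : 0 <= g false u by lra.
  have := g_incr true u0 uc (ltW c1); lra.
clearbody C t B; exists C => //; move=> w; move: {2}(size w) (leqnn (size w)) => n.
elim: n w => [|n IH] w; first by case: w => // _ x y _ _; rewrite mulr_ge0.
(* a run of [m.+1] letters [b] has already been read *)
have run b m w' x y : (size w' <= n)%N -> p <= x <= q -> p <= y <= q ->
    \sum_(k < m.+1) `|iter k.+1 (g b) x - iter k.+1 (g b) y| +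
    orbdist w' (iter m.+1 (g b) x) (iter m.+1 (g b) y) <= C * `|x - y|.
  elim: w' m => [|b' w' IHw] m sw xK yK.
    rewrite /= addr0; have := HB' b m.+1 x y xK yK.
    have d0 := normr_ge0 (x - y).
    have : B * `|x - y| <= C * `|x - y|.
      by apply: ler_wpM2r => //; have := mulr_ge0 C0 (proj1 (andP tI)); lra.
    lra.
  have [bb'|bb'] := eqVneq b b'.
    have := IHw m.+1 (ltnW sw) xK yK.
    by rewrite -bb' big_ord_recr /= addrA.
  have h1 := HB' b m.+1 x y xK yK.
  have xI := I _ xK; have yI := I _ yK.
  have h2 : `|iter m.+1 (g b) x - iter m.+1 (g b) y| <= t * `|x - y|.
    rewrite !iterSr; apply: le_trans (Ht b x y xK yK).
    by apply: Idist; exact: g01.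
  have h3 := IH w' (ltnW sw) _ _ (back b b' m x xK bb') (back b b' m y yK bb').
  have h4 : `|g b' (iter m.+1 (g b) x) - g b' (iter m.+1 (g b) y)| <= t * `|x - y|.
    apply: le_trans h2; have := iter_g01 b m.+1 xI; have := iter_g01 b m.+1 yI => ? ?.
    by apply: g_dist; exact: itv01W.
  have h5 := ler_wpM2l C0 h4; have d0 := normr_ge0 (x - y).
  have h6 := ler_wpM2r d0 CE; rewrite !mulrDl -!mulrA in h6.
  move: h1 h3 h4 h5 h6 => /=; lra.
case: w => [|b w] sw x y xK yK; first by rewrite mulr_ge0.
have := run b 0%N w x y sw xK yK.
by rewrite big_ord_recl big_ord0 addr0.
Qed.

(** * Densities and distribution functions of the image measures *)

Variables (rho0 F0 : R -> R).
Hypothesis rho0_cont : forall x, {for x, continuous rho0}.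
Hypothesis rho0_gt0 : forall x, 0 < rho0 x.
Hypothesis F0_0 : F0 0 = 0.
Hypothesis F0_der : forall x, 0 <= x <= 1 -> is_derive x 1 F0 (rho0 x).

(** The densities of the image measures, by the transfer operator. *)
Fixpoint rho n x : R := if n is m.+1 then
  rho m (g false x) * dg false x + rho m (g true x) * dg true x else rho0 x.

(** The preimage of [0, x] consists of [0, g false x] and ]c, g true x]. *)
Fixpoint cumul n x : R := if n is m.+1 then
  cumul m (g false x) + cumul m (g true x) - cumul m c else F0 x.

Lemma rho_cont n x : {for x, continuous (rho n)}.
Proof.
elim: n x => [//|n IH] x.
apply: continuousD; apply: continuousM; try exact: dg_cont;
  by apply: continuous_comp; [exact: g_cont|exact: IH].
Qed.

Lemma rho_gt0 n x : 0 < rho n x.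
Proof. by elim: n x => //= n IH x; rewrite addr_gt0// mulr_gt0. Qed.

Lemma cumul_der n x : 0 < x < 1 -> is_derive x 1 (cumul n) (rho n x).
Proof.
elim: n x => [|n IH] x xI /=; first by apply: F0_der; lra.
have h b : is_derive x 1 (cumul n \o g b) (rho n (g b x) * dg b x).
  have ? := IH _ (g01 b xI); have ? := g_der b xI; exact: is_derive1_comp.
have h1 := h false; have h2 := h true.
rewrite -[X in is_derive _ _ _ X]subr0.
exact: (is_deriveB (is_deriveD h1 h2) (is_derive_cst _ _ _)).
Qed.

Lemma cumul_cont n x : 0 <= x <= 1 -> {for x, continuous (cumul n)}.
Proof.
elim: n x => [|n IH] x xI; first exact: is_derive_continuous (F0_der xI).
apply: continuousB; last exact: cvg_cst.
apply: continuousD; apply: (@continuous_comp _ _ _ (g _) (cumul n));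
  by [exact: g_cont|exact: IH (g01w _ xI)].
Qed.

Lemma cumul_0 n : cumul n 0 = 0.
Proof. by elim: n => //= n IH; rewrite !g_0 IH; lra. Qed.

Lemma cumul_1 n : cumul n 1 = F0 1.
Proof. by elim: n => //= n IH; rewrite !g_1 IH; lra. Qed.

Lemma cumul_mvt n x y : 0 <= x -> x < y -> y <= 1 ->
  exists2 z, x < z < y & cumul n y - cumul n x = rho n z * (y - x).
Proof.
move=> x0 xy y1; apply: mvt => // z zxy; last by apply: cumul_cont; lra.
by apply: cumul_der; lra.
Qed.

Lemma cumul_le n x y : 0 <= x -> x <= y -> y <= 1 -> cumul n x <= cumul n y.
Proof.
move=> x0; rewrite le_eqVlt => /predU1P[->//|xy y1].
have [z zxy e] := cumul_mvt n x0 xy y1.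
have zI : 0 < z < 1 by lra.
by rewrite -subr_ge0 e mulr_ge0 ?subr_ge0 ?(ltW xy)// ltW// rho_gt0.
Qed.

Lemma cumul01 n x : 0 <= x <= 1 -> 0 <= cumul n x <= F0 1.
Proof.
move=> /andP[x0 x1]; have := cumul_le n (lexx 0) x0 x1.
by have := cumul_le n x0 x1 (lexx 1); rewrite cumul_0 cumul_1 => -> ->.
Qed.

Lemma F0_1_gt0 : 0 < F0 1.
Proof.
have [z zI e] := cumul_mvt 0 (lexx 0) ltr01 (lexx 1).
by move: e => /=; rewrite F0_0 !subr0 mulr1 => ->.
Qed.

(** A sum of positive terms has at most the distortion of its worst term, so it is
    enough to bound the distortion along each word separately. *)
Lemma rho_distortion n x y d E Q : 0 < x < 1 -> 0 < y < 1 -> `|x - y| <= d ->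
  (forall u v, 0 <= u <= 1 -> 0 <= v <= 1 -> `|u - v| <= d ->
     rho0 u <= Q * rho0 v) ->
  (forall w, size w = n -> orbdist w x y <= E) ->
  rho n x <= Q * expR (D * E) * rho n y.
Proof.
move=> + + + HQ; have Q0 : 0 <= Q -> forall t, 0 <= Q * expR t.
  by move=> q0 t; rewrite mulr_ge0 ?expR_ge0.
elim: n x y E => [|n IH] x y E xI yI xy HE.
  have := HE [::] erefl => /= E0.
  have xI' : 0 <= x <= 1 by lra.
  have yI' : 0 <= y <= 1 by lra.
  apply: le_trans (HQ _ _ xI' yI' xy) _; have ry := rho0_gt0 y.
  have q0 : 0 <= Q.
    have := HQ _ _ xI' yI' xy; have := rho0_gt0 x.
    by move=> a b; rewrite -(pmulr_lge0 _ ry); lra.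
  by rewrite ler_wpM2r ?(ltW ry)// ler_peMr// -expR0 ler_expR mulr_ge0.
rewrite /= mulrDr; apply: lerD.
all: set b := (X in g X x).
all: have gxI := g01 b xI; have gyI := g01 b yI.
all: have dx := dg01 b xI; have dy := dg01 b yI.
all: have gxy : `|g b x - g b y| <= d by apply: le_trans xy; apply: g_dist; lra.
all: have h := IH _ _ (E - `|g b x - g b y|) gxI gyI gxy.
all: have {h} : rho n (g b x) <= Q * expR (D * (E - `|g b x - g b y|)) * rho n (g b y)
  by apply: h => w sw; rewrite lerBrDl; apply: (HE (b :: w)); rewrite /= sw.
all: move=> h; have := ler_pM (ltW (rho_gt0 n (g b x))) (ltW (proj1 (andP dx))) h
  (g_distortion b xI yI).
all: move/le_trans; apply.
all: rewrite [leLHS](_ : _ = Q * (expR (D * (E - `|g b x - g b y|)) *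
  expR (D * `|g b x - g b y|)) * (rho n (g b y) * dg b y)); last by ring.
all: by rewrite -expRD -mulrDr subrK.
Qed.

Lemma rho0_ratio_bound : exists2 Q, 1 <= Q &
  forall u v, 0 <= u <= 1 -> 0 <= v <= 1 -> rho0 u <= Q * rho0 v.
Proof.
have [a aI amin] := segment_min (@ler01 R) rho0_cont.
have [b bI bmax] := segment_max (@ler01 R) rho0_cont.
have ra := rho0_gt0 a.
exists (rho0 b / rho0 a) => [|u v uI vI].
  by rewrite ler_pdivlMr// mul1r; exact: amin.
apply: le_trans (bmax u uI) _; rewrite mulrAC ler_pdivlMr//.
by apply: ler_wpM2l; [exact/ltW/rho0_gt0|exact: amin].
Qed.

Lemma rho0_log_unif_cont e : 0 < e -> exists2 d, 0 < d &
  forall u v, 0 <= u <= 1 -> 0 <= v <= 1 -> `|u - v| <= d ->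
    rho0 u <= (1 + e) * rho0 v.
Proof.
move=> e0; have [a aI amin] := segment_min (@ler01 R) rho0_cont.
have ra := rho0_gt0 a; have era : 0 < e * rho0 a by rewrite mulr_gt0.
have [d d0 Hd] := segment_unif_cont 0 1 rho0_cont era.
exists (d / 2) => [|u v uI vI uv]; first by lra.
have /ltr_normlW h : `|rho0 u - rho0 v| < e * rho0 a by apply: Hd => //; lra.
have := ler_wpM2l (ltW e0) (amin v vI); lra.
Qed.

Lemma orbdist_bound_segment p q : 0 < p -> q < 1 ->
  exists2 B, 0 <= B & forall w x y, p <= x <= q -> p <= y <= q ->
    orbdist w x y <= B * `|x - y|.
Proof.
move=> p0 q1.
have lI := g01 false c01; have rI := g01 true c01.
have lc := gl_ltc c01; have rc := gr_gtc c01.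
have [||||B B0 HB] := @orbdist_bound (Num.min p (g false c)) (Num.max q (g true c)).
- by rewrite lt_min p0; case/andP: lI.
- by rewrite ge_min lexx orbT.
- by rewrite le_max lexx orbT.
- by rewrite gt_max q1; case/andP: rI.
exists B => // w x y /andP[px xq] /andP[py yq].
by apply: HB; rewrite ge_min le_max ?px ?xq ?py ?yq.
Qed.

(** What remains of the regularity of [rho0] on compact intervals of (0, 1) at
    all times: the bound on distortion depends neither on the word nor on its
    length. *)
Lemma rho_harnack p q : 0 < p -> q < 1 -> exists2 C, 1 <= C &
  forall n x y, p <= x <= q -> p <= y <= q -> rho n x <= C * rho n y.
Proof.
move=> p0 q1; have [B B0 HB] := orbdist_bound_segment p0 q1.
have [Q Q1 HQ] := rho0_ratio_bound.
exists (Q * expR (D * B)) => [|n x y xK yK].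
  by rewrite -[1]mulr1; apply: ler_pM => //; rewrite -expR0 ler_expR mulr_ge0.
have xI : 0 < x < 1 by lra.
have yI : 0 < y < 1 by lra.
apply: (@rho_distortion n x y 1) => //; first by rewrite ler_norml; lra.
  by move=> u v uI vI _; exact: HQ.
move=> w _; apply: le_trans (HB w x y xK yK) _; rewrite ler_piMr// ler_norml; lra.
Qed.

Lemma rho_equicont p q e : 0 < p -> q < 1 -> 0 < e -> exists2 d, 0 < d &
  forall n x y, p <= x <= q -> p <= y <= q -> `|x - y| <= d ->
    rho n x <= (1 + e) * rho n y.
Proof.
move=> p0 q1 e0; have [B B0 HB] := orbdist_bound_segment p0 q1.
have e2 : 0 < e / 2 by lra.
have [d1 d10 HQ] := rho0_log_unif_cont e2.
pose s := (1 + e) / (1 + e / 2).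
have s1 : 1 < s by rewrite /s ltr_pdivlMr; lra.
have ls0 := ln_gt0 s1.
pose d2 := ln s / (D * B + 1).
have DB0 : 0 <= D * B by rewrite mulr_ge0.
have DB : 0 < D * B + 1 by lra.
have d20 : 0 < d2 by rewrite divr_gt0.
exists (Num.min d1 d2) => [|n x y xK yK]; first by rewrite lt_min d10.
rewrite le_min => /andP[xy1 xy2].
have xI : 0 < x < 1 by lra.
have yI : 0 < y < 1 by lra.
apply: le_trans (rho_distortion xI yI xy1 HQ (fun w _ => HB w x y xK yK)) _.
rewrite ler_wpM2r//; first exact/ltW/rho_gt0.
have -> : 1 + e = (1 + e / 2) * s by rewrite /s mulrC divfK// gt_eqF; lra.
rewrite ler_wpM2l//; first by lra.
rewrite -[leRHS]lnK ?posrE; last by lra.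
rewrite ler_expR mulrA; apply: le_trans (_ : D * B * d2 <= _); first exact: ler_wpM2l.
rewrite /d2 mulrA ler_pdivrMr// mulrC ler_wpM2l//; lra.
Qed.

(** * A monotone quantity and the ratio of successive densities *)

(** Half the harmonic mean, or parallel sum, of two successive densities. *)
Definition parsum n x := rho n x * rho n.+1 x / (rho n x + rho n.+1 x).

(** How much [parsum] fails to be transported as a density; the failure has a sign
    because the parallel sum is superadditive. *)
Definition parsum_gap n x := parsum n.+1 x -
  (parsum n (g false x) * dg false x + parsum n (g true x) * dg true x).

Definition ratio n x := rho n.+1 x / rho n x.

Lemma ratio_gt0 n x : 0 < ratio n x.
Proof. by rewrite divr_gt0// rho_gt0. Qed.

Lemma rhoS n x : rho n.+1 x =
  rho n (g false x) * dg false x + rho n (g true x) * dg true x.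
Proof. by []. Qed.

Lemma rhoSE n x : rho n.+1 x = ratio n x * rho n x.
Proof. by rewrite /ratio divfK// gt_eqF// rho_gt0. Qed.

Lemma parsum_gapE n x :
  let A := rho n (g false x) * dg false x in
  let B := rho n (g true x) * dg true x in
  let wl := ratio n (g false x) in let wr := ratio n (g true x) in
  parsum_gap n x = A * B * (wl - wr) ^+ 2 /
    ((1 + wl) * (1 + wr) * (A * (1 + wl) + B * (1 + wr))).
Proof.
rewrite /parsum_gap /parsum !(rhoS _ x) !rhoSE.
have := ratio_gt0 n (g false x); have := ratio_gt0 n (g true x).
have := rho_gt0 n (g false x); have := rho_gt0 n (g true x).
have := dg_gt0 false x; have := dg_gt0 true x.
move: (ratio _ _) (ratio _ _) (rho _ _) (rho _ _) (dg _ _) (dg _ _).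
move=> wr wl a b d e d0 e0 b0 a0 wr0 wl0 /=.
by field; apply/and5P; split; rewrite gt_eqF//;
  repeat first [assumption | exact: ltr01 | apply: addr_gt0 | apply: mulr_gt0].
Qed.

Lemma parsum_gap_ge0 n x : 0 <= parsum_gap n x.
Proof.
rewrite parsum_gapE; have := sqr_ge0 (ratio n (g false x) - ratio n (g true x)).
move: (_ ^+ 2) => d d0; rewrite divr_ge0// ?mulr_ge0// ltW//;
  repeat first [exact: ratio_gt0 | exact: rho_gt0 | exact: dg_gt0 | exact: ltr01 |
    apply: addr_gt0 | apply: mulr_gt0].
Qed.

Lemma parsum_cont n x : {for x, continuous (parsum n)}.
Proof.
apply: continuousM; first by apply: continuousM; exact: rho_cont.
apply: continuousV; first by rewrite gt_eqF// (addr_gt0 (rho_gt0 _ _) (rho_gt0 _ _)).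
by apply: continuousD; exact: rho_cont.
Qed.

Lemma parsum_le n x : parsum n x <= rho n x.
Proof.
have r0 := rho_gt0 n x; have r1 := rho_gt0 n.+1 x.
by rewrite /parsum ler_pdivrMr ?(addr_gt0 r0 r1)// ler_wpM2l ?(ltW r0)// lerDr ltW.
Qed.

(** Half the harmonic mean of two successive densities has an integral that
    grows with time and stays bounded; its increments are the integrals of
    [parsum_gap], which measure how far the two preimages of a point are from
    having the same ratio of successive densities.  Everything is expressed with
    primitives, so that the change of variables is the chain rule. *)
Lemma parsum_entropy : exists2 H : nat -> R,
  (forall n, H n <= F0 1) &
  forall n x y, 0 <= x -> x < y -> y <= 1 -> exists2 z, x < z < y &
    parsum_gap n z * (y - x) <= H n.+1 - H n.
Proof.
have /choice[G HG] : forall n, exists G : R -> R, G 0 = 0 /\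
    forall x, -1 < x < 2 -> is_derive x 1 G (parsum n x).
  by move=> n; have [G G0 GE] := primitive (fun x => @parsum_cont n x); exists G.
have G0 n := (HG n).1; have G_der n := (HG n).2.
have G_cont n x : 0 <= x <= 1 -> {for x, continuous (G n)}.
  by move=> xI; apply: is_derive_continuous (G_der n x _); lra.
exists (fun n => G n 1) => [n|n x y x0 xy y1].
  pose K : R -> R := G n - cumul n.
  have [z zI] : exists2 z : R, 0 < z < 1 & K 1 - K 0 = (parsum n z - rho n z) * (1 - 0).
    apply: mvt => // z zI.
      have ? := cumul_der n zI; have ? : is_derive z 1 (G n) (parsum n z).
        by apply: G_der; lra.
      exact: is_deriveB.
    by apply: continuousB; [exact: G_cont|exact: cumul_cont].
  have := parsum_le n z.
  by rewrite /K !fctE /= G0 cumul_0 cumul_1; lra.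
pose K : R -> R := G n.+1 - ((G n \o g false) + (G n \o g true) - cst (G n c)).
have K_der (z : R) : 0 < z < 1 -> is_derive z 1 K (parsum_gap n z).
  move=> zI; have d b : is_derive z 1 (G n \o g b) (parsum n (g b z) * dg b z).
    have ? := g_der b zI; have /andP[? ?] := g01 b zI.
    have ? : is_derive (g b z) 1 (G n) (parsum n (g b z)) by apply: G_der; lra.
    exact: is_derive1_comp.
  have d1 := d false; have d2 := d true.
  have d3 : is_derive z 1 (G n.+1) (parsum n.+1 z) by apply: G_der; lra.
  have d4 : is_derive z 1 (cst (G n c) : R -> R) 0 by exact: is_derive_cst.
  have := is_deriveB d3 (is_deriveB (is_deriveD d1 d2) d4).
  by rewrite subr0.
have K_cont (z : R) : 0 <= z <= 1 -> {for z, continuous K}.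
  move=> zI; apply: continuousB; first exact: G_cont.
  apply: continuousB; last exact: cvg_cst.
  by apply: continuousD; apply: continuous_comp; try exact: g_cont;
    apply: G_cont; exact: g01w.
have K_mvt (s t : R) : 0 <= s -> s < t -> t <= 1 -> exists2 z : R, s < z < t &
    K t - K s = parsum_gap n z * (t - s).
  by move=> s0 st t1; apply: mvt => // z zI; [apply: K_der|apply: K_cont]; lra.
have K_le (s t : R) : 0 <= s -> s <= t -> t <= 1 -> K s <= K t.
  move=> s0; rewrite le_eqVlt => /predU1P[->//|st t1].
  have [z _ e] := K_mvt s t s0 st t1.
  by rewrite -subr_ge0 e mulr_ge0 ?parsum_gap_ge0// subr_ge0 ltW.
have [z zxy e] := K_mvt x y x0 xy y1; exists z => //; rewrite -e.
have y0 : 0 <= y by lra. have x1 : x <= 1 by lra.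
have := K_le _ _ (lexx 0) x0 x1; have := K_le _ _ y0 y1 (lexx 1).
by rewrite /K !fctE /= !g_0 !g_1 !G0; lra.
Qed.

Lemma ratio_bound p q : 0 < p -> q < 1 -> exists2 C, 1 <= C &
  forall n x, p <= x <= q -> ratio n x <= C.
Proof.
move=> p0 q1; case: (leP p q) => [pq|qp]; last by exists 1 => // n x; lra.
have pI : 0 < p < 1 by lra. have qI : 0 < q < 1 by lra.
have /andP[lp0 lp1] := g01 false pI; have /andP[rq0 rq1] := g01 true qI.
have lp := g_sign false pI; have rq := g_sign true qI.
rewrite expr0 mul1r in lp; rewrite expr1 in rq.
have [C C1 HC] := rho_harnack lp0 rq1.
exists (2 * C) => [|n x xK]; first by lra.
rewrite /ratio ler_pdivrMr ?rho_gt0// rhoS.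
have xI : 0 < x < 1 by lra.
have H b : rho n (g b x) * dg b x <= C * rho n x.
  have gx : g false p <= g b x <= g true q.
    have := @g_le b p x; have := @g_le b x q; have := gl_ltc xI; have := gr_gtc xI.
    have := gl_ltc pI; have := gr_gtc qI; case: b; lra.
  apply: le_trans (HC n (g b x) x gx _); last by lra.
  by rewrite ler_piMr ?(ltW (rho_gt0 _ _))// ltW// dg_lt1.
have := H false; have := H true; lra.
Qed.

Lemma ratio_equicont p q e : 0 < p -> q < 1 -> 0 < e -> exists2 d, 0 < d &
  forall n x y, p <= x <= q -> p <= y <= q -> `|x - y| <= d ->
    `|ratio n x - ratio n y| <= e.
Proof.
move=> p0 q1 e0; have [C C1 HC] := ratio_bound p0 q1.
pose s := Num.min 1 (e / (3 * C)).
have C0 : 0 < C by lra.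
have s0 : 0 < s by rewrite lt_min ltr01 divr_gt0// mulr_gt0.
have s1 : s <= 1 by rewrite ge_min lexx.
have sC : 3 * s * C <= e.
  have : s <= e / (3 * C) by rewrite ge_min lexx orbT.
  by rewrite ler_pdivlMr ?mulr_gt0//; lra.
have [d d0 Hd] := rho_equicont p0 q1 s0.
exists d => // n x y xK yK xy.
have H x' y' : p <= x' <= q -> p <= y' <= q -> `|x' - y'| <= d ->
    ratio n x' - ratio n y' <= e.
  move=> xK' yK' xy'.
  have h1 := Hd n.+1 _ _ xK' yK' xy'.
  have h2 : rho n y' <= (1 + s) * rho n x' by apply: Hd => //; rewrite distrC.
  have a0 := rho_gt0 n x'; have b0 := rho_gt0 n y'.
  rewrite !rhoSE in h1.
  have : ratio n x' <= (1 + s) * (1 + s) * ratio n y'.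
    rewrite -(ler_pM2r a0); apply: le_trans h1 _.
    rewrite [leRHS](_ : _ = (1 + s) * (ratio n y' * ((1 + s) * rho n x'))); last by ring.
    by rewrite ler_wpM2l ?ler_wpM2l ?(ltW (ratio_gt0 _ _))//; lra.
  have h3 := HC n y' yK'; have h4 := ratio_gt0 n y'.
  have : s * s <= s * 1 by rewrite ler_wpM2l// ltW.
  move=> ss; have := ler_wpM2r (ltW h4) ss.
  have : s * ratio n y' <= s * C by rewrite ler_wpM2l// ltW.
  lra.
rewrite ler_norml; have := H x y xK yK xy.
have := H y x yK xK; rewrite distrC => /(_ xy); lra.
Qed.

Lemma parsum_gap_lower n x a C : 0 < a ->
  (forall b, a <= rho n (g b x) * dg b x) ->
  (forall b, ratio n (g b x) <= C) ->
  a * (ratio n (g false x) - ratio n (g true x)) ^+ 2 <=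
    2 * (1 + C) ^+ 3 * parsum_gap n x.
Proof.
move=> a0 Ha HC; rewrite parsum_gapE /=.
have [A0 B0] := (Ha false, Ha true); have [wlC wrC] := (HC false, HC true).
have := ratio_gt0 n (g false x); have := ratio_gt0 n (g true x).
move: (rho n _ * dg false x) (rho n _ * dg true x) (ratio n _) (ratio n _) A0 B0 wlC wrC.
move=> A B wr wl aA aB wlC wrC wr0 wl0.
have d0 := sqr_ge0 (wl - wr); move: (_ ^+ 2) d0 => d d0.
set den := (X in _ / X).
have A0 : 0 < A by lra. have B0 : 0 < B by lra.
have den0 : 0 < den.
  by repeat first [assumption | exact: ltr01 | apply: addr_gt0 | apply: mulr_gt0].
rewrite [leRHS]mulrA ler_pdivlMr// [leLHS]mulrAC [leRHS]mulrA ler_wpM2r//.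
have h1 : den <= (1 + C) * (1 + C) * ((A + B) * (1 + C)).
  apply: ler_pM; [by rewrite mulr_ge0//; lra| |by apply: ler_pM; lra|].
    by rewrite addr_ge0// mulr_ge0//; lra.
  by rewrite mulrDl; apply: lerD; apply: ler_wpM2l; lra.
have h2 : a * (A + B) <= 2 * (A * B).
  have := ler_wpM2r (ltW B0) aA; have := ler_wpM2l (ltW A0) aB; lra.
have C3 : 0 <= (1 + C) ^+ 3 by rewrite exprn_ge0; lra.
apply: le_trans (ler_wpM2l (ltW a0) h1) _.
rewrite [leLHS](_ : _ = (1 + C) ^+ 3 * (a * (A + B))); last by ring.
apply: le_trans (ler_wpM2l C3 h2) _.
by rewrite [leLHS](_ : _ = 2 * (1 + C) ^+ 3 * (A * B))//; ring.
Qed.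

(** Smallness along the times at which the density at [c] is not small: as long
    as the latter is not known to tend to 0, the ratios are only controlled at
    such times. *)
Definition small (v : nat -> R) := forall d e, 0 < d -> 0 < e ->
  exists N, forall n, (N <= n)%N -> d <= rho n c -> `|v n| <= e.

Lemma smallD u v : small u -> small v -> small (fun n => u n + v n).
Proof.
move=> su sv d e d0 e0; have e2 : 0 < e / 2 by lra.
have [N1 H1] := su _ _ d0 e2; have [N2 H2] := sv _ _ d0 e2.
exists (maxn N1 N2) => n; rewrite geq_max => /andP[n1 n2] dn.
have := H1 n n1 dn; have := H2 n n2 dn; have := ler_normD (u n) (v n); lra.
Qed.

Lemma small_le (N : nat) u v : (forall n, (N <= n)%N -> `|v n| <= `|u n|) ->
  small u -> small v.
Proof.
move=> uv su d e d0 e0; have [N1 H1] := su _ _ d0 e0.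
exists (maxn N N1) => n; rewrite geq_max => /andP[n1 n2] dn.
exact: le_trans (uv n n1) (H1 n n2 dn).
Qed.

(** A bounded monotone sequence has small increments, so [parsum_gap] is small at
    some point close to [x]; equicontinuity brings the conclusion back to [x]. *)
Lemma ratio_preimages x : 0 < x < 1 ->
  small (fun n => ratio n (g false x) - ratio n (g true x)).
Proof.
move=> xI d e d0 e0; pose x2 := (1 + x) / 2.
have x2I : x < x2 < 1 by rewrite /x2; lra.
have x2I' : 0 < x2 < 1 by lra.
pose p := g false x; pose q := g true x2.
have p0 : 0 < p by case/andP: (g01 false xI).
have q1 : q < 1 by case/andP: (g01 true x2I').
have pc : p < c by exact: gl_ltc. have cq : c < q by exact: gr_gtc.
have gK b z : x <= z <= x2 -> p <= g b z <= q.
  move=> zI; have zI' : 0 < z < 1 by lra.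
  have := gl_ltc zI'; have := gr_gtc zI'.
  have := @g_le b x z; have := @g_le b z x2; rewrite /p /q.
  by case: b => /=; have := pc; have := cq; rewrite /p /q; lra.
have [C1 C11 HC1] := rho_harnack p0 q1.
have [C2 C21 HC2] := ratio_bound p0 q1.
have e4 : 0 < e / 4 by lra.
have [d1 d10 Hd1] := ratio_equicont p0 q1 e4.
have [m1 m1I Hm1] := segment_min (ltW (proj1 (andP x2I))) (@dg_cont false).
have [m2 m2I Hm2] := segment_min (ltW (proj1 (andP x2I))) (@dg_cont true).
pose m := Num.min (dg false m1) (dg true m2).
have m0 : 0 < m by rewrite lt_min !dg_gt0.
have Hm b z : x <= z <= x2 -> m <= dg b z.
  by move=> zI; rewrite ge_min; case: b; rewrite ?Hm1 ?Hm2 ?orbT.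
pose a := m * (d / C1).
have C10 : 0 < C1 by lra.
have a0 : 0 < a by rewrite mulr_gt0// divr_gt0.
pose y := Num.min x2 (x + d1).
have xy : x < y by rewrite lt_min; lra.
have yx2 : y <= x2 by rewrite ge_min lexx.
have yd : y <= x + d1 by rewrite ge_min lexx orbT.
have [H HM Hgap] := parsum_entropy.
have Hi n : H n <= H n.+1.
  have [z _ h] := Hgap n _ _ (lexx 0) ltr01 (lexx 1).
  by have := parsum_gap_ge0 n z; lra.
pose C3 := 2 * (1 + C2) ^+ 3.
have C30 : 0 < C3 by rewrite mulr_gt0// exprn_gt0; lra.
pose eta := (e / 2) ^+ 2 * a * (y - x) / C3.
have eta0 : 0 < eta.
  by rewrite divr_gt0// mulr_gt0 ?subr_gt0// mulr_gt0// exprn_gt0; lra.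
have [N HN] := increments_small HM Hi eta0.
exists N => n Nn dn.
have x0 : 0 <= x by lra. have y1 : y <= 1 by lra.
have [z zxy hz] := Hgap n x y x0 xy y1.
have zK : x <= z <= x2 by lra.
have xK : x <= x <= x2 by lra.
have cK : p <= c <= q by lra.
have Ha b : a <= rho n (g b z) * dg b z.
  rewrite mulrC; apply: ler_pM; [exact: ltW|by rewrite divr_ge0// ltW|exact: Hm|].
  by rewrite ler_pdivrMr// mulrC; apply: le_trans dn _; apply: HC1 => //; exact: gK.
have HC b : ratio n (g b z) <= C2 by apply: HC2; exact: gK.
have := parsum_gap_lower a0 Ha HC; rewrite -/C3.
set del := ratio n (g false z) - _ => hdel.
have del_le : `|del| <= e / 2.
  have e20 : 0 <= e / 2 by lra.
  rewrite -(ler_pXn2r (ltn0Sn 1)) ?nnegrE// real_normK ?num_real//.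
  rewrite -(ler_pM2l a0); apply: le_trans hdel _.
  have yx : 0 < y - x by lra.
  rewrite -(ler_pM2r yx) -[leLHS]mulrA.
  have h := le_trans hz (HN n Nn); rewrite -(ler_pM2l C30) in h.
  apply: le_trans h _.
  by rewrite /eta mulrC divfK ?gt_eqF// [a * _]mulrC.
have hx b : `|ratio n (g b x) - ratio n (g b z)| <= e / 4.
  apply: Hd1; [exact: gK|exact: gK|].
  apply: le_trans (_ : `|x - z| <= _); first by apply: g_dist; lra.
  by rewrite ler_norml; lra.
have := hx true; have := hx false; move: del_le; rewrite /del.
by rewrite !ler_norml; lra.
Qed.

(** Ratios are bounded, so a density that is not small at [c] was not small there
    one step earlier. *)
Lemma small_pred v : small v -> small (fun n => v n.-1).
Proof.
move=> sv d e d0 e0; have /andP[c0 c1] := c01.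
have [C C1 HC] := ratio_bound c0 c1.
have C0 : 0 < C by lra.
have dC : 0 < d / C by rewrite divr_gt0.
have [N HN] := sv _ _ dC e0.
exists N.+1 => -[//|n]; rewrite ltnS => Nn dn; apply: HN => //=.
rewrite ler_pdivrMr//; apply: le_trans dn _; rewrite rhoSE mulrC.
by rewrite ler_wpM2l ?HC ?lexx// ltW// rho_gt0.
Qed.

Lemma small_sub k v : small v -> small (fun n => v (n - k)%N).
Proof.
move=> sv; elim: k => [|k /small_pred].
  by apply: (small_le (N := 0)) sv => n _; rewrite subn0.
by apply: (small_le (N := 0)) => n _; rewrite -subn1 -subnDA add1n.
Qed.

(** The next ratio at [x] is a weighted mean of the ratios at the preimages of [x]. *)
Lemma ratio_step b x : 0 < x < 1 ->
  small (fun n => ratio n x - ratio n.-1 (g b x)).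
Proof.
move=> xI; apply: (small_le (N := 1)) (small_pred (ratio_preimages xI)).
case=> // m _ /=; rewrite {1}/ratio !(rhoS _ x) !rhoSE.
set A := rho m (g false x) * dg false x; set B := rho m (g true x) * dg true x.
set wl := ratio m (g false x); set wr := ratio m (g true x).
have A0 : 0 < A by rewrite mulr_gt0 ?rho_gt0.
have B0 : 0 < B by rewrite mulr_gt0 ?rho_gt0.
have AB0 : 0 < A + B by lra.
rewrite -(mulrA wl) -(mulrA wr) -/A -/B.
case: b; rewrite -/wl -/wr.
  have -> : (wl * A + wr * B) / (A + B) - wr = (wl - wr) * (A / (A + B)).
    by field; rewrite gt_eqF.
  rewrite normrM ler_piMr// ger0_norm ?divr_ge0 ?ltW// ltr_pdivrMr//; lra.
have -> : (wl * A + wr * B) / (A + B) - wl = (wr - wl) * (B / (A + B)).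
  by field; rewrite gt_eqF.
rewrite normrM [leRHS]distrC ler_piMr// ger0_norm ?divr_ge0 ?ltW// ltr_pdivrMr//; lra.
Qed.

Let lr x := g false (g true x).

Lemma iter_lr01 k x : 0 < x < 1 -> 0 < iter k lr x < 1.
Proof. by move=> xI; elim: k => //= k IH; rewrite /lr !g01. Qed.

Lemma ratio_iter k x : 0 < x < 1 ->
  small (fun n => ratio n x - ratio (n - k.*2)%N (iter k lr x)).
Proof.
move=> xI; elim: k => [|k IH].
  move=> d e d0 e0; exists 0%N => n _ _.
  by rewrite double0 subn0 subrr normr0 ltW.
have yI := iter_lr01 k xI; set y := iter k lr x in yI IH *.
have s1 := small_sub k.*2 (ratio_step true yI).
have s2 := small_sub k.*2.+1 (ratio_step false (g01 true yI)).
apply: (small_le (N := 0)) (smallD IH (smallD s1 s2)) => n _.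
rewrite doubleS iterS -/y !subnS.
have -> : ratio n x - ratio (n - k.*2).-1.-1 (lr y) =
  ratio n x - ratio (n - k.*2) y + (ratio (n - k.*2) y -
  ratio (n - k.*2).-1 (g true y) + (ratio (n - k.*2).-1 (g true y) -
  ratio (n - k.*2).-1.-1 (g false (g true y)))) by rewrite /lr; lra.
by [].
Qed.

(** Going back in time along the contraction [lr] brings [x] and [y] together. *)
Lemma ratio_space x y : 0 < x < 1 -> 0 < y < 1 ->
  small (fun n => ratio n x - ratio n y).
Proof.
move=> xI yI d e d0 e0.
have e3 : 0 < e / 3 by lra.
have lc := g01 false c01; have rc := g01 true c01.
pose p := g false c; pose q := g true c.
have p0 : 0 < p by case/andP: lc. have q1 : q < 1 by case/andP: rc.
have pc : p < c := gl_ltc c01; have cq : c < q := gr_gtc c01.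
have pq : p <= q by lra.
have hK z : 0 < z < 1 -> p <= lr z <= q.
  move=> zI; have rz := g01 true zI; have crz := gr_gtc zI.
  have := gl_ltc rz; have := @g_incr false c (g true z); rewrite -/p -/(lr z).
  have := c01; lra.
have [t tI Ht] := g_contraction true p0 pq q1.
have [d1 d10 Hd1] := ratio_equicont p0 q1 e3.
have tk k : `|iter k.+1 lr x - iter k.+1 lr y| <= t ^+ k.
  elim: k => [|k IH].
    rewrite expr0; have := hK x xI; have := hK y yI; rewrite ler_norml /=; lra.
  rewrite exprS iterS [iter k.+2 lr y]iterS.
  have uI := iter_lr01 k.+1 xI; have vI := iter_lr01 k.+1 yI.
  have uK := hK _ (iter_lr01 k xI); have vK := hK _ (iter_lr01 k yI).
  have ruI := g01 true uI; have rvI := g01 true vI.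
  apply: le_trans (_ : t * `|iter k.+1 lr x - iter k.+1 lr y| <= _).
    by apply: le_trans (Ht _ _ uK vK); apply: g_dist; exact: itv01W.
  by rewrite ler_wpM2l//; lra.
have [k tkd] : exists k, t ^+ k <= d1.
  have t1 : `|t| < 1 by rewrite ger0_norm; lra.
  have /cvgrPdist_lt/(_ _ d10)[k _ Hk] := cvg_expr t1.
  exists k; have := Hk k (leqnn k); rewrite /= sub0r normrN => /ltW.
  by apply: le_trans; exact: ler_norm.
have [N1 H1] := ratio_iter k.+1 xI d0 e3.
have [N2 H2] := ratio_iter k.+1 yI d0 e3.
exists (maxn N1 N2) => n; rewrite geq_max => /andP[n1 n2] dn.
have := H1 n n1 dn; have := H2 n n2 dn.
have := Hd1 (n - k.+1.*2)%N _ _ (hK _ (iter_lr01 k xI)) (hK _ (iter_lr01 k yI))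
  (le_trans (tk k) tkd).
by rewrite -!iterS !ler_norml; lra.
Qed.

(** Going back one step moves the point to a preimage of [c], which [ratio_space]
    replaces by [c]. *)
Lemma ratio_time k : small (fun n => ratio n c - ratio (n - k)%N c).
Proof.
elim: k => [|k IH].
  by move=> d e d0 e0; exists 0%N => n _ _; rewrite subn0 subrr normr0 ltW.
have s1 := small_sub k (ratio_step false c01).
have s2 := small_sub k.+1 (ratio_space (g01 false c01) c01).
apply: (small_le (N := 0)) (smallD IH (smallD s1 s2)) => n _.
rewrite subnS.
have -> : ratio n c - ratio (n - k).-1 c =
  ratio n c - ratio (n - k) c + (ratio (n - k) c -
  ratio (n - k).-1 (g false c) + (ratio (n - k).-1 (g false c) -
  ratio (n - k).-1 c)) by lra.
by [].
Qed.

(** * The density at the discontinuity tends to zero *)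

(** The mass to the left of [c] is decomposed according to its last entrance there,
    if this happened during the last [k] steps. *)
Lemma cumul_last_entrance n k : (k <= n)%N -> cumul n c =
  cumul (n - k) (iter k (g false) c) +
  \sum_(i < k) (cumul (n - i.+1) (g true (iter i (g false) c)) - cumul (n - i.+1) c).
Proof.
elim: k => [|k IH] kn; first by rewrite subn0 big_ord0 addr0.
rewrite IH ?(ltnW kn)// big_ord_recr /= (_ : (n - k)%N = (n - k.+1).+1) /=.
  lra.
by rewrite subnSK.
Qed.

Lemma cumulC_last_entrance n k : (k <= n)%N -> F0 1 - cumul n c =
  F0 1 - cumul (n - k) (iter k (g true) c) +
  \sum_(i < k) (cumul (n - i.+1) c - cumul (n - i.+1) (g false (iter i (g true) c))).
Proof.
elim: k => [|k IH] kn; first by rewrite subn0 big_ord0 addr0.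
rewrite IH ?(ltnW kn)// big_ord_recr /= (_ : (n - k)%N = (n - k.+1).+1) /=.
  lra.
by rewrite subnSK.
Qed.

Definition gap_right i := g true (iter i (g false) c) - c.
Definition gap_left i := c - g false (iter i (g true) c).

Hypothesis gap_right_dvg : forall A, exists k, A <= \sum_(i < k) gap_right i.

Lemma gap_right_gt0 i : 0 < gap_right i.
Proof. by rewrite subr_gt0; apply: gr_gtc; exact: iter_g01. Qed.

Lemma gap_left_gt0 i : 0 < gap_left i.
Proof. by rewrite subr_gt0; apply: gl_ltc; exact: iter_g01. Qed.

Lemma iter_left_le i : iter i (g false) c <= c.
Proof.
elim: i => //= i IH; apply: le_trans IH; have uI := iter_g01 false i c01.
by have := g_sign false uI; rewrite expr0 mul1r subr_gt0 => /ltW.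
Qed.

Lemma iter_right_ge i : c <= iter i (g true) c.
Proof.
elim: i => //= i IH; apply: le_trans IH _; have uI := iter_g01 true i c01.
by have := g_sign true uI; rewrite expr1; lra.
Qed.

Lemma gap_right_in i : c < g true (iter i (g false) c) <= g true c.
Proof.
rewrite gr_gtc ?iter_g01//= g_le//; [|exact: iter_left_le|by case/andP: c01 => _ /ltW].
by case/andP: (iter_g01 false i c01) => /ltW.
Qed.

Lemma gap_left_in i : g false c <= g false (iter i (g true) c) < c.
Proof.
rewrite gl_ltc ?iter_g01//= andbT g_le//; [by case/andP: c01 => /ltW|exact: iter_right_ge|].
by case/andP: (iter_g01 true i c01) => _ /ltW.
Qed.

(** All entrances on either side of [c] come from this interval. *)
Lemma harnack_c : exists2 C, 1 <= C & forall n x, g false c <= x <= g true c ->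
  rho n x <= C * rho n c /\ rho n c <= C * rho n x.
Proof.
have /andP[p0 _] := g01 false c01; have /andP[_ q1] := g01 true c01.
have pc : g false c < c := gl_ltc c01; have cq : c < g true c := gr_gtc c01.
have [C C1 HC] := rho_harnack p0 q1; exists C => // n x xK.
by split; apply: HC => //; lra.
Qed.

Lemma entry_right n i : exists2 z, c < z < g true (iter i (g false) c) &
  cumul n (g true (iter i (g false) c)) - cumul n c = rho n z * gap_right i.
Proof.
have /andP[cg gc] := gap_right_in i; have /andP[_ rc] := g01 true c01.
by apply: cumul_mvt => //; [case/andP: c01 => /ltW|lra].
Qed.

Lemma entry_left n i : exists2 z, g false (iter i (g true) c) < z < c &
  cumul n c - cumul n (g false (iter i (g true) c)) = rho n z * gap_left i.
Proof.
have /andP[cg gc] := gap_left_in i; have /andP[lc _] := g01 false c01.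
by apply: cumul_mvt => //; [lra|case/andP: c01 => _ /ltW].
Qed.

Lemma rho_c_bounded : exists B, forall n, rho n c <= B.
Proof.
have [C C1 HC] := harnack_c.
exists (C * (F0 1 / gap_right 0)) => n; have e0 := gap_right_gt0 0.
have [z zI e] := entry_right n 0; have zc := gap_right_in 0.
have lc : g false c < c := gl_ltc c01.
have [|_ hz] := HC n z; first by lra.
apply: le_trans hz _; rewrite ler_wpM2l//; first by lra.
rewrite ler_pdivlMr// -e; have /andP[c0 c1] := c01.
have rI : 0 <= g true (iter 0 (g false) c) <= 1 by have := g01 true c01 => /=; lra.
have cI : 0 <= c <= 1 by lra.
have := cumul01 n rI; have := cumul01 n cI; lra.
Qed.

(** If the density at [c] had a positive upper limit [U], then the ratios of
    successive densities would be nearly constant and at most about 1 before the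
    times at which it is close to [U], so it would have been above [U / 4] at many
    earlier times too; but the mass to the left of [c] at such a time is at least
    the sum of the corresponding entrances, which diverges with their number. *)
Lemma rho_c_cvg0 e : 0 < e -> exists N, forall n, (N <= n)%N -> rho n c <= e.
Proof.
move=> e0; have [B HB] := rho_c_bounded.
pose E := [set a | exists N, forall n, (N <= n)%N -> rho n c <= a].
have E0 : lbound E 0.
  by move=> a [N HN]; apply: le_trans (HN N (leqnn N)); exact/ltW/rho_gt0.
have Einf : has_inf E by split; [exists B; exists 0%N => n _; exact: HB | exists 0].
have Uup t : inf E < t -> exists N, forall n, (N <= n)%N -> rho n c <= t.
  move=> Ut; have [|a [N HN] at_] := inf_adherent (eps := t - inf E) _ Einf.
    by rewrite subr_gt0.
  exists N => n /HN; lra.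
have Ulo t N : t < inf E -> exists2 n, (N <= n)%N & t < rho n c.
  move=> tU; apply: contrapT => nex.
  have : inf E <= t; last by lra.
  apply: ge_inf; first by exists 0.
  exists N => n Nn; rewrite leNgt; apply/negP => tn; apply: nex; exists n => //.
case: (leP (inf E) 0) => U0; first by apply: Uup; lra.
exfalso; move: (inf E) U0 Uup Ulo => U U0 Uup Ulo {E E0 Einf}.
have [C C1 HC] := harnack_c; have C0 : 0 < C by lra.
have M0 := F0_1_gt0.
(* So many entrances, through densities at least [U / (4 * C)], exceed the total mass. *)
have [k Hk] := gap_right_dvg (4 * C * F0 1 / U + 1).
(* With ratios at most [1 + s], the density at [c] varies by at most a quarter of
   [U] over [k] steps. *)
pose s : R := (8 * k.+1%:R)^-1.
have k1 : 1 <= k.+1%:R :> R by rewrite ler1n.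
have s0 : 0 < s by rewrite invr_gt0; lra.
have s1 : s <= 1 by rewrite invf_le1; lra.
have sk : k%:R * s <= 8^-1.
  rewrite /s invfM mulrCA ler_piMr// ler_pdivrMr; last by lra.
  by rewrite mul1r ler_nat.
have s2 : 0 < s / 2 by lra. have U2 : 0 < U / 2 by lra.
have /choice[Nt HNt] i := ratio_time i U2 s2.
have [N1 HN1] := Uup (U * (1 + s / 8)) ltac:(rewrite ltr_pMr//; lra).
have [N2 HN2] := Uup (2 * U) ltac:(lra).
pose N := (\max_(i < k.+1) Nt i + N1 + N2 + k)%N.
have [n Nn un] := Ulo (U * (1 - s / 8)) N ltac:(rewrite gtr_pMr//; lra).
have [nNt nN1 nN2 kn] := leq_add4_split Nn.
have sU : s * U <= U by rewrite ler_piMl// ltW.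
have un2 : U / 2 <= rho n c by lra.
have ratio_n : ratio n c <= 1 + s / 2.
  have h1 : rho n.+1 c <= U * (1 + s / 8).
    exact/HN1/leqW.
  rewrite rhoSE in h1; rewrite -(ler_pM2r (rho_gt0 n c)); apply: le_trans h1 _.
  have hz : (1 + s / 2) * (U * (1 - s / 8)) <= (1 + s / 2) * rho n c.
    by rewrite ler_wpM2l; lra.
  apply: le_trans hz; rewrite mulrCA ler_pM2l//.
  have : s * s <= s by rewrite ler_piMr// ltW.
  lra.
have ratio_k i : (i <= k)%N -> ratio (n - i) c <= 1 + s.
  move=> ik; have : (Nt i <= n)%N.
    have : (Nt i <= \max_(i < k.+1) Nt i)%N.
      exact: (@leq_bigmax _ (fun i : 'I_k.+1 => Nt i) (Ordinal (ik : (i < k.+1)%N))).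
    by move/leq_trans; apply.
  move=> /HNt/(_ un2); rewrite ler_norml; lra.
have back i : (i <= k)%N -> rho n c - 2 * i%:R * s * U <= rho (n - i) c.
  elim: i => [|i IH] ik; first by rewrite subn0; lra.
  have ni : (n - i = (n - i.+1).+1)%N by rewrite subnSK// (leq_trans ik).
  have := IH (ltnW ik); rewrite ni rhoSE.
  have h1 := ler_wpM2r (ltW (rho_gt0 (n - i.+1) c)) (ratio_k _ ik).
  have h2 : rho (n - i.+1) c <= 2 * U by apply: HN2; exact: leq_subr_addl nN2 ik.
  have := ler_wpM2l (ltW s0) h2; rewrite -(natr1 i); lra.
have back4 i : (i <= k)%N -> U / 4 <= rho (n - i) c.
  move=> ik; apply: le_trans (back i ik).
  have : i%:R * s <= 8^-1 by apply: le_trans sk; rewrite ler_wpM2r ?ler_nat// ltW.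
  by move/(ler_wpM2r (ltW U0)); lra.
have /andP[c0 c1] := c01; have cI : 0 <= c <= 1 by lra.
have := cumul01 n cI; rewrite (cumul_last_entrance kn) => /andP[_].
have yI := iter_g01 false k c01; have yI' : 0 <= iter k (g false) c <= 1 by lra.
have /andP[y0 _] := cumul01 (n - k) yI'.
have lc : g false c < c := gl_ltc c01.
have : \sum_(i < k) (U / (4 * C) * gap_right i) <=
    \sum_(i < k) (cumul (n - i.+1) (g true (iter i (g false) c)) - cumul (n - i.+1) c).
  apply: ler_sum => i _; have [z zI ->] := entry_right (n - i.+1) i.
  have zc := gap_right_in i.
  rewrite ler_wpM2r ?(ltW (gap_right_gt0 _))//.
  have [|_ hz] := HC (n - i.+1)%N z; first by lra.
  rewrite invfM mulrA ler_pdivrMr// [leRHS]mulrC.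
  exact: le_trans (back4 i.+1 (ltn_ord i)) hz.
rewrite -mulr_sumr.
have UC : 0 < U / (4 * C) by rewrite divr_gt0//; lra.
have := ler_wpM2l (ltW UC) Hk; rewrite mulrDr mulr1.
have -> : U / (4 * C) * (4 * C * F0 1 / U) = F0 1.
  by field; rewrite !gt_eqF.
lra.
Qed.

Lemma iter_false_cvg0 : iter n (g false) c @[n --> \oo] --> (0 : R).
Proof.
have noni : nonincreasing_seq (fun n => iter n (g false) c).
  apply/nonincreasing_seqP => n /=; have uI := iter_g01 false n c01.
  by have := g_sign false uI; rewrite expr0 mul1r subr_gt0 => /ltW.
have ge0 n : 0 <= iter n (g false) c by case/andP: (iter_g01 false n c01) => /ltW.
have cv : cvgn (fun n => iter n (g false) c).
  by apply: nonincreasing_is_cvgn => //; exists 0 => _ [n _ <-].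
set L := limn _ in cv; have L0 : 0 <= L by apply: limr_ge => //; exact: nearW.
have Lc : L <= c by apply: limr_le => //; apply: nearW => n; exact: iter_left_le.
have gL : g false L = L.
  have h1 : g false (iter n (g false) c) @[n --> \oo] --> g false L.
    exact: (cvg_comp _ _ cv (@g_cont false L)).
  have h2 : iter n.+1 (g false) c @[n --> \oo] --> L.
    by rewrite (cvg_shiftS (fun n => iter n (g false) c)).
  exact: (cvg_unique _ h1 h2).
have [L1|L1] := eqVneq L 0; first by move: cv; rewrite /= -/L L1.
have LI : 0 < L < 1 by have := c01; lra.
by have := g_sign false LI; rewrite gL subrr mulr0 ltxx.
Qed.

Lemma iter_true_cvg1 : iter n (g true) c @[n --> \oo] --> (1 : R).
Proof.
have nond : nondecreasing_seq (fun n => iter n (g true) c).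
  apply/nondecreasing_seqP => n /=; have uI := iter_g01 true n c01.
  by have := g_sign true uI; rewrite expr1; lra.
have le1 n : iter n (g true) c <= 1 by case/andP: (iter_g01 true n c01) => _ /ltW.
have cv : cvgn (fun n => iter n (g true) c).
  by apply: nondecreasing_is_cvgn => //; exists 1 => _ [n _ <-].
set L := limn _ in cv; have L1 : L <= 1 by apply: limr_le => //; exact: nearW.
have Lc : c <= L by apply: limr_ge => //; apply: nearW => n; exact: iter_right_ge.
have gL : g true L = L.
  have h1 : g true (iter n (g true) c) @[n --> \oo] --> g true L.
    exact: (cvg_comp _ _ cv (@g_cont true L)).
  have h2 : iter n.+1 (g true) c @[n --> \oo] --> L.
    by rewrite (cvg_shiftS (fun n => iter n (g true) c)).
  exact: (cvg_unique _ h1 h2).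
have [E|E] := eqVneq L 1; first by move: cv; rewrite /= -/L E.
have LI : 0 < L < 1 by have := c01; lra.
by have := g_sign true LI; rewrite gL subrr mulr0 ltxx.
Qed.

(** * Balance between the masses on the two sides of the discontinuity *)

Variable kap : R.
Hypothesis kap_gt0 : 0 < kap.
Hypothesis gap_ratio : gap_right i / gap_left i @[i --> \oo] --> kap.

(** The mass that enters [0, c], respectively [c, 1], at the [i.+1]-st step before
    time [n] and stays there until then; before that step it is within
    [gap_right i], respectively [gap_left i], of [c]. *)
Definition in_right n i :=
  cumul (n - i.+1) (g true (iter i (g false) c)) - cumul (n - i.+1) c.
Definition in_left n i :=
  cumul (n - i.+1) c - cumul (n - i.+1) (g false (iter i (g true) c)).

Lemma in_right_ge0 n i : 0 <= in_right n i.
Proof.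
have /andP[c0 c1] := c01; have /andP[? ?] := gap_right_in i.
have /andP[_ q1] := g01 true c01.
by rewrite subr_ge0 cumul_le//; lra.
Qed.

Lemma in_left_ge0 n i : 0 <= in_left n i.
Proof.
have /andP[c0 c1] := c01; have /andP[? ?] := gap_left_in i.
have /andP[p0 _] := g01 false c01.
by rewrite subr_ge0 cumul_le//; lra.
Qed.

(** For large [i] the intervals of entrance are so short that the density is nearly
    constant on their union, and the masses are as the lengths. *)
Lemma remote_entries e : 0 < e -> exists I, forall n i, (I <= i)%N ->
  `|in_right n i - kap * in_left n i| <= e * (in_right n i + in_left n i).
Proof.
move=> e0; have kap0 := kap_gt0; have /andP[c0 c1] := c01.
(* The densities contribute a relative error [3 * s], the lengths an error [s] on
   [kap]. *)
pose K1 := 4 + 3 * kap; have K10 : 0 < K1 by rewrite /K1; lra.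
pose s := Num.min 1 (e / K1).
have s0 : 0 < s by rewrite lt_min ltr01 divr_gt0.
have s1 : s <= 1 by rewrite ge_min lexx.
have sK : s * K1 <= e by rewrite -ler_pdivlMr// ge_min lexx orbT.
have p0 : 0 < g false c by case/andP: (g01 false c01).
have q1 : g true c < 1 by case/andP: (g01 true c01).
have pc : g false c < c := gl_ltc c01; have cq : c < g true c := gr_gtc c01.
have [d d0 Hd] := rho_equicont p0 q1 s0.
have cvr : g true (iter i (g false) c) @[i --> \oo] --> c.
  by have := cvg_comp _ _ iter_false_cvg0 (@g_cont true 0); rewrite g_0.
have cvl : g false (iter i (g true) c) @[i --> \oo] --> c.
  by have := cvg_comp _ _ iter_true_cvg1 (@g_cont false 1); rewrite g_1.
have [I1 H1] := cvg_seq_le cvr d0; have [I2 H2] := cvg_seq_le cvl d0.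
have [I3 H3] := cvg_seq_le gap_ratio s0.
exists (maxn I1 (maxn I2 I3)) => n i; rewrite !geq_max => /and3P[i1 i2 i3].
have {}H1 := H1 i i1; have {}H2 := H2 i i2; have {}H3 := H3 i i3.
have gr := gap_right_gt0 i; have gl := gap_left_gt0 i.
have /andP[h1 h2] : (kap - s) * gap_left i <= gap_right i <= (kap + s) * gap_left i.
  move: H3; rewrite ler_norml => /andP[? ?].
  by apply/andP; split; [rewrite -ler_pdivlMr//|rewrite -ler_pdivrMr//]; lra.
have a0 := in_right_ge0 n i; have b0 := in_left_ge0 n i.
have [z zI ea] := entry_right (n - i.+1) i; have zi := gap_right_in i.
have [t tI eb] := entry_left (n - i.+1) i; have ti := gap_left_in i.
rewrite -/(in_right n i) in ea; rewrite -/(in_left n i) in eb.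
have zc : `|z - c| <= d by move: H1; rewrite !ler_norml; lra.
have tc : `|t - c| <= d by move: H2; rewrite !ler_norml; lra.
have zK : g false c <= z <= g true c by lra.
have tK : g false c <= t <= g true c by lra.
have cK : g false c <= c <= g true c by lra.
have {}Hd := Hd (n - i.+1)%N.
move: (rho (n - i.+1)) (fun x => rho_gt0 (n - i.+1) x) Hd ea eb => r r0 Hd ea eb.
have r1 : r z <= (1 + s) * r c by exact: Hd.
have r2 : r c <= (1 + s) * r z by apply: Hd => //; rewrite distrC.
have r3 : r t <= (1 + s) * r c by exact: Hd.
have r4 : r c <= (1 + s) * r t by apply: Hd => //; rewrite distrC.
have {zc tc zK tK cK Hd zI tI zi ti cvr cvl H1 H2 H3 p0 q1 pc cq} rz0 := r0 z.
have rt0 := r0 t.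
have ss : s * s <= s by rewrite ler_piMr// ltW.
have zt : r z <= (1 + 3 * s) * r t.
  have : (1 + s) * r c <= (1 + s) * ((1 + s) * r t) by rewrite ler_wpM2l//; lra.
  by have := ler_wpM2r (ltW rt0) ss; lra.
have tz : r t <= (1 + 3 * s) * r z.
  have : (1 + s) * r c <= (1 + s) * ((1 + s) * r z) by rewrite ler_wpM2l//; lra.
  by have := ler_wpM2r (ltW rz0) ss; lra.
have s30 : 0 <= 1 + 3 * s by lra.
have f1 : in_right n i <= (1 + 3 * s) * (kap + s) * in_left n i.
  rewrite ea eb [leRHS](_ : _ = (1 + 3 * s) * r t * ((kap + s) * gap_left i)); last by ring.
  by apply: ler_pM => //; exact: ltW.
have f2 : (kap - s) * in_left n i <= (1 + 3 * s) * in_right n i.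
  rewrite ea eb [leRHS](_ : _ = ((1 + 3 * s) * r z) * gap_right i); last by ring.
  rewrite [leLHS](_ : _ = r t * ((kap - s) * gap_left i)); last by ring.
  apply: le_trans (_ : r t * gap_right i <= _); first by rewrite ler_wpM2l// ltW.
  by rewrite ler_wpM2r// ltW.
move: (in_right n i) (in_left n i) a0 b0 f1 f2 => a b a0 b0 f1 f2.
apply: le_trans (_ : s * K1 * (a + b) <= _); last by rewrite ler_wpM2r// addr_ge0.
have sa := mulr_ge0 (ltW s0) a0; have sb := mulr_ge0 (ltW s0) b0.
have ka := mulr_ge0 (ltW kap0) sa; have kb := mulr_ge0 (ltW kap0) sb.
have sb2 := ler_wpM2r b0 ss.
by rewrite ler_norml /K1; lra.
Qed.

(** There are boundedly many such intervals, and the density on them tends to 0. *)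
Lemma recent_entries I e : 0 < e -> exists N, forall n i, (N + I <= n)%N ->
  (i < I)%N -> `|in_right n i - kap * in_left n i| <= e.
Proof.
move=> e0; have kap0 := kap_gt0; have /andP[c0 c1] := c01.
have p0 : 0 < g false c by case/andP: (g01 false c01).
have q1 : g true c < 1 by case/andP: (g01 true c01).
have pc : g false c < c := gl_ltc c01; have cq : c < g true c := gr_gtc c01.
have [C C1 HC] := harnack_c.
have kC0 : 0 < (1 + kap) * C by rewrite mulr_gt0//; lra.
pose u0 := e / ((1 + kap) * C).
have u00 : 0 < u0 by rewrite divr_gt0.
have [N1 HN1] := rho_c_cvg0 u00; exists N1 => n i nI iI.
have ru : rho (n - i.+1) c <= u0 by apply: HN1; exact: leq_subr_addl nI iI.
have [z zI ea] := entry_right (n - i.+1) i; have zi := gap_right_in i.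
have [t tI eb] := entry_left (n - i.+1) i; have ti := gap_left_in i.
rewrite -/(in_right n i) in ea; rewrite -/(in_left n i) in eb.
have Cu : C * rho (n - i.+1) c <= C * u0 by rewrite ler_wpM2l//; lra.
have gr1 : gap_right i <= 1 by rewrite /gap_right; lra.
have gl1 : gap_left i <= 1 by rewrite /gap_left; lra.
have ha : in_right n i <= C * u0.
  rewrite ea; apply: le_trans Cu; have [|hz _] := HC (n - i.+1)%N z; first by lra.
  by apply: le_trans hz; rewrite ler_piMr// ltW// rho_gt0.
have hb : in_left n i <= C * u0.
  rewrite eb; apply: le_trans Cu; have [|hz _] := HC (n - i.+1)%N t; first by lra.
  by apply: le_trans hz; rewrite ler_piMr// ltW// rho_gt0.
have Cu0 : (1 + kap) * (C * u0) = e.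
  by rewrite /u0; field; apply/andP; split; rewrite gt_eqF//; lra.
have := ler_wpM2l (ltW kap_gt0) hb.
have := mulr_ge0 (ltW kap_gt0) (in_left_ge0 n i).
have := in_right_ge0 n i.
by rewrite ler_norml; lra.
Qed.

(** At time [n] both sides of [c] are filled by entrances, up to a mass that was
    always close to an end point.  The entrances of long ago are in the proportion
    [kap], and those of a bounded number of last steps are negligible because the
    density at [c] tends to 0. *)
Lemma cumul_balance e : 0 < e -> exists N, forall n, (N <= n)%N ->
  `|cumul n c - kap * (F0 1 - cumul n c)| <= e.
Proof.
move=> e0; have kap0 := kap_gt0; have M0 := F0_1_gt0.
have e1 : 0 < e / (4 * F0 1) by rewrite divr_gt0//; lra.
have [I HI] := remote_entries e1.
have I0 : 0 < I.+1%:R :> R by rewrite ltr0n.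
have e2 : 0 < e / (4 * I.+1%:R) by rewrite divr_gt0//; lra.
have [N1 HN1] := recent_entries I e2.
have e3 : 0 < e / (4 * (1 + kap)) by rewrite divr_gt0//; lra.
have F_at x : 0 <= x <= 1 -> {for x, continuous F0}.
  by move=> xI; exact: is_derive_continuous (F0_der xI).
have cF0 : F0 (iter n (g false) c) @[n --> \oo] --> F0 0.
  by apply: cvg_comp iter_false_cvg0 (F_at 0 _); rewrite lexx ler01.
have cF1 : F0 (iter n (g true) c) @[n --> \oo] --> F0 1.
  by apply: cvg_comp iter_true_cvg1 (F_at 1 _); rewrite lexx ler01.
have [N2 HN2] := cvg_seq_le cF0 e3; have [N3 HN3] := cvg_seq_le cF1 e3.
exists (N2 + N3 + N1 + I)%N => n /leq_add4_split[n2 n3 n1 _].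
have eA : cumul n c = F0 (iter n (g false) c) + \sum_(i < n) in_right n i.
  by rewrite (cumul_last_entrance (leqnn n)) subnn.
have eB : F0 1 - cumul n c = F0 1 - F0 (iter n (g true) c) + \sum_(i < n) in_left n i.
  by rewrite (cumulC_last_entrance (leqnn n)) subnn.
have main : `|\sum_(i < n) (in_right n i - kap * in_left n i)| <= e / 2.
  apply: le_trans (ler_norm_sum _ _ _) _.
  have hh i : `|in_right n i - kap * in_left n i| <=
      (if (i < I)%N then e / (4 * I.+1%:R) else 0) +
      e / (4 * F0 1) * (in_right n i + in_left n i).
    have : 0 <= e / (4 * F0 1) * (in_right n i + in_left n i).
      by rewrite mulr_ge0 ?(ltW e1)// addr_ge0 ?in_right_ge0 ?in_left_ge0.
    case: ltnP => iI; last by rewrite add0r => _; exact: HI.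
    by move=> h; apply: le_trans (HN1 n i n1 iI) _; rewrite lerDl.
  apply: le_trans (ler_sum _ (fun (i : 'I_n) _ => hh i)) _.
  rewrite big_split /= -mulr_sumr big_split /=.
  have t1 := sum_initial_le I n (ltW e2).
  have t2 : I%:R * (e / (4 * I.+1%:R)) <= e / 4.
    rewrite (_ : _ * _ = e / 4 * (I%:R / I.+1%:R)).
      by rewrite ler_piMr ?ler_pdivrMr ?mul1r ?ler_nat//; lra.
    by field; rewrite gt_eqF.
  have F_ge0 : 0 <= F0 (iter n (g false) c).
    have yI := iter_g01 false n c01; have yI' : 0 <= iter n (g false) c <= 1 by lra.
    by case/andP: (cumul01 0 yI').
  have F_leM : F0 (iter n (g true) c) <= F0 1.
    have yI := iter_g01 true n c01; have yI' : 0 <= iter n (g true) c <= 1 by lra.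
    by case/andP: (cumul01 0 yI').
  have sab : \sum_(i < n) in_right n i + \sum_(i < n) in_left n i <= F0 1 by lra.
  have := ler_wpM2l (ltW e1) sab.
  have -> : e / (4 * F0 1) * F0 1 = e / 4 by field; rewrite gt_eqF.
  move=> h; apply: le_trans (lerD (le_trans t1 t2) h) _; lra.
have -> : cumul n c - kap * (F0 1 - cumul n c) =
    F0 (iter n (g false) c) + kap * (F0 (iter n (g true) c) - F0 1) +
    \sum_(i < n) (in_right n i - kap * in_left n i).
  by rewrite sumrB -mulr_sumr eB {1}eA; lra.
have h2 := HN2 n n2; have h3 := HN3 n n3; rewrite F0_0 subr0 in h2.
apply: le_trans (ler_normD _ _) _; apply: le_trans (lerD (ler_normD _ _) main) _.
rewrite normrM (gtr0_norm kap_gt0).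
have := ler_wpM2l (ltW kap_gt0) h3.
have : (1 + kap) * (e / (4 * (1 + kap))) = e / 4 by field; rewrite gt_eqF//; lra.
lra.
Qed.

Lemma cumul_cvg x : 0 < x < 1 ->
  cumul n x @[n --> \oo] --> kap / (1 + kap) * F0 1.
Proof.
move=> xI; have kap0 := kap_gt0; apply/cvgrPdist_le => e e0; have /andP[c0 c1] := c01.
have e2 : 0 < e / 2 by lra.
have [N1 HN1] := cumul_balance e2.
pose p := Num.min x c; pose q := Num.max x c.
have [p0 q1] : 0 < p /\ q < 1 by rewrite lt_min gt_max c0 c1; lra.
have xK : p <= x <= q by rewrite ge_min le_max lexx.
have cK : p <= c <= q by rewrite ge_min le_max lexx !orbT.
have [C C1 HC] := rho_harnack p0 q1.
have eC : 0 < e / (2 * C) by rewrite divr_gt0//; lra.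
have [N2 HN2] := rho_c_cvg0 eC.
exists (maxn N1 N2) => // n /=; rewrite geq_max => /andP[n1 n2].
have h1 : `|cumul n x - cumul n c| <= e / 2.
  have H y z : p <= y <= q -> p <= z <= q -> y < z ->
      `|cumul n z - cumul n y| <= e / 2.
    move=> yK zK yz; have y0 : 0 <= y by lra. have z1 : z <= 1 by lra.
    have [t tI ->] := cumul_mvt n y0 yz z1.
    have tK : p <= t <= q by lra.
    have h := HC n t c tK cK; have h' := HN2 n n2.
    rewrite ger0_norm; last by rewrite mulr_ge0 ?(ltW (rho_gt0 _ _))//; lra.
    apply: le_trans (_ : rho n t <= _).
      by rewrite ler_piMr ?(ltW (rho_gt0 _ _))//; lra.
    apply: le_trans h _; rewrite mulrC -ler_pdivlMr; last by lra.
    by apply: le_trans h' _; rewrite invfM mulrA.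
  case: (ltgtP x c) => [xc|cx|->]; last by rewrite subrr normr0; lra.
    by rewrite distrC; exact: H.
  exact: H.
have h2 := HN1 n n1; have k1 : 0 < 1 + kap by lra.
have h3 : `|kap / (1 + kap) * F0 1 - cumul n c| <= e / 2.
  rewrite (_ : _ - _ = - (cumul n c - kap * (F0 1 - cumul n c)) / (1 + kap)); last first.
    by field; rewrite gt_eqF.
  rewrite normrM normrN (gtr0_norm (_ : 0 < (1 + kap)^-1)) ?invr_gt0//.
  rewrite ler_pdivrMr//; apply: le_trans h2 _; rewrite ler_peMr//; lra.
move: h1 h3; rewrite !ler_norml; lra.
Qed.

End branches.

(** * One-sided derivatives *)

Section derivative_within.
Variable R : realType.
Implicit Types (g : R -> R) (D : set R) (x : R).

Lemma pos_min (u v : R) : 0 < u -> 0 < v -> exists m, [/\ 0 < m, m <= u & m <= v].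
Proof.
by move=> u0 v0; exists (Num.min u v); rewrite lt_min u0 !ge_min !lexx orbT.
Qed.

Lemma derivable_withinP D g x : derivable_within D g x -> forall e, 0 < e ->
  exists2 d, 0 < d & forall y, `|x - y| < d -> D y -> y != x ->
    `|derive_within D g x - (g y - g x) / (y - x)| < e.
Proof.
move=> dg e e0; have : (fun y => (g y - g x) / (y - x)) @ within D x^' -->
  derive_within D g x by exact: dg.
move=> /cvgrPdist_lt/(_ _ e0)[d /= d0 H]; exists d => // y xy Dy yx.
exact: (H y xy yx Dy).
Qed.

Lemma derivable_within_lip D g x : derivable_within D g x ->
  exists K, [/\ 0 < K.1, 0 < K.2 & forall y, `|x - y| < K.1 -> D y ->
    `|g x - g y| <= K.2 * `|x - y|].
Proof.
move=> dg; have [d d0 H] := derivable_withinP dg ltr01.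
exists (d, `|derive_within D g x| + 1); split => //= y xy Dy.
have [->|yx] := eqVneq y x; first by rewrite !subrr normr0 mulr0.
have := H y xy Dy yx; set q := _ / _ => hq.
have -> : g x - g y = q * (x - y).
  by rewrite /q; field; rewrite subr_eq0.
rewrite normrM ler_wpM2r//.
have := ler_normB (derive_within D g x) (derive_within D g x - q).
rewrite opprB addrCA subrr addr0; lra.
Qed.

Lemma derivable_within_continuous D g :
  (forall x, D x -> derivable_within D g x) -> {within D, continuous g}.
Proof.
move=> dg; apply/subspace_continuousP => x Dx.
have [[d K] [/= d0 K0 H]] := derivable_within_lip (dg x Dx).
apply/cvgrPdist_lt => e e0.
have [m [m0 md me]] := pos_min d0 (divr_gt0 e0 K0).
exists m => //= y xy Dy.
apply: le_lt_trans (H y (lt_le_trans xy md) Dy) _; rewrite mulrC -ltr_pdivlMr//.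
exact: lt_le_trans xy me.
Qed.

Lemma derivable_within_is_derive D g x : nbhs x D -> derivable_within D g x ->
  is_derive x 1 g (derive_within D g x).
Proof.
move=> [d1 /= d10 xD] dg.
have H : (fun h => h^-1 *: (g (h *: 1 + x) - g x)) @ 0^' --> derive_within D g x.
  apply/cvgrPdist_lt => e e0.
  have [d2 d20 H] := derivable_withinP dg e0.
  have [m [m0 md1 md2]] := pos_min d10 d20.
  exists m => // h; rewrite /= sub0r normrN => hm h0.
  have h1 := lt_le_trans hm md1; have h2 := lt_le_trans hm md2.
  rewrite scaler1 /GRing.scale /=.
  have e1 : x - (h + x) = - h by lra.
  have := H (h + x); rewrite e1 normrN => /(_ h2).
  rewrite (_ : h + x - x = h); last by lra.
  rewrite mulrC; apply; first by apply: xD; rewrite /= e1 normrN.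
  by apply: contra_neq h0 => hx; lra.
by split; [apply/cvg_ex; eexists; exact: H | exact: cvg_lim H].
Qed.

End derivative_within.

(** * The inverse of a full branch *)

Section inverse_branch.
Variables (R : realType) (a b : R) (f : R -> R).
Hypothesis ab : a < b.
Hypothesis f_C2 : C2_on `[a, b] f.
Hypothesis f_img : f @` `[a, b] = `[0, 1]%classic.

Let d := derive_within `[a, b] f.

Hypothesis d_gt1 : forall y, a < y < b -> 1 < d y.

Lemma segment_nbhs y : a < y < b -> nbhs y `[a, b]%classic.
Proof.
move=> yI; have := @near_in_itvoo R a b y; rewrite in_itv => /(_ yI).
by apply: filterS => z; rewrite /= !in_itv /= => /andP[/ltW -> /ltW ->].
Qed.

Lemma branch_derivable y : a <= y <= b -> derivable_within `[a, b] f y.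
Proof. by case: f_C2 => h _ _ yI; apply: h; rewrite inE /= in_itv. Qed.

Lemma branch_der_derivable y : a <= y <= b -> derivable_within `[a, b] d y.
Proof. by case: f_C2 => _ h _ yI; apply: h; rewrite inE /= in_itv. Qed.

Lemma branch_is_derive y : a < y < b -> is_derive y 1 f (d y).
Proof.
move=> yI; apply: derivable_within_is_derive; first exact: segment_nbhs.
by apply: branch_derivable; lra.
Qed.

Lemma branch_continuous : {within `[a, b], continuous f}.
Proof.
apply: derivable_within_continuous => y /=; rewrite in_itv /=.
exact: branch_derivable.
Qed.

Lemma branch_der_continuous : {within `[a, b], continuous d}.
Proof.
apply: derivable_within_continuous => y /=; rewrite in_itv /=.
exact: branch_der_derivable.
Qed.

Lemma subsegment_continuous (h : R -> R) u v : {within `[a, b], continuous h} ->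
  a <= u -> v <= b -> {within `[u, v], continuous h}.
Proof.
move=> + au vb; apply: continuous_subspaceW => y /=; rewrite !in_itv /=; lra.
Qed.

Lemma branch_mvt u v : a <= u -> u < v -> v <= b ->
  exists2 y, u < y < v & f v - f u = d y * (v - u).
Proof.
move=> au uv vb; have dE y : y \in `]u, v[ -> is_derive y 1 f (d y).
  by rewrite in_itv /= => yI; apply: branch_is_derive; lra.
have [y] := MVT uv dE (subsegment_continuous branch_continuous au vb).
by rewrite in_itv /= => yI e; exists y.
Qed.

Lemma branch_expand u v : a <= u -> u <= v -> v <= b -> v - u <= f v - f u.
Proof.
move=> au; rewrite le_eqVlt => /predU1P[->|uv vb]; first by rewrite !subrr.
have [y yI ->] := branch_mvt au uv vb.
by rewrite ler_peMl ?subr_ge0 ?(ltW uv)// ltW// d_gt1//; lra.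
Qed.

Lemma branch_le u v : a <= u -> u <= v -> v <= b -> f u <= f v.
Proof. by move=> au uv vb; have := branch_expand au uv vb; lra. Qed.

Lemma branch_image y : a <= y <= b -> 0 <= f y <= 1.
Proof.
move=> yI; have : (f @` `[a, b]) (f y) by exists y => //=; rewrite in_itv.
by rewrite f_img /= in_itv.
Qed.

Lemma branch_surj x : 0 <= x <= 1 -> exists2 y, a <= y <= b & f y = x.
Proof.
move=> xI; have : (f @` `[a, b]) x by rewrite f_img /= in_itv.
by move=> [y]; rewrite /= in_itv /= => yI e; exists y.
Qed.

Lemma branch_a : f a = 0.
Proof.
have [|y yI fy] := branch_surj (x := 0); first by rewrite lexx ler01.
have /andP[h _] : 0 <= f a <= 1 by apply: branch_image; lra.
have : f a <= f y by apply: branch_le; lra.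
lra.
Qed.

Lemma branch_b : f b = 1.
Proof.
have [|y yI fy] := branch_surj (x := 1); first by rewrite lexx ler01.
have /andP[_ h] : 0 <= f b <= 1 by apply: branch_image; lra.
have : f y <= f b by apply: branch_le; lra.
lra.
Qed.

Lemma branch_der_lip : exists2 L, 0 <= L & forall u v, a <= u <= b -> a <= v <= b ->
  `|d u - d v| <= L * `|u - v|.
Proof.
have d2c : {within `[a, b], continuous (derive_within `[a, b] d)} by case: f_C2.
have d2E y : a < y < b -> is_derive y 1 d (derive_within `[a, b] d y).
  move=> yI; apply: derivable_within_is_derive; first exact: segment_nbhs.
  by apply: branch_der_derivable; lra.
have [y1 _ H1] := EVT_max (ltW ab) d2c; have [y2 _ H2] := EVT_min (ltW ab) d2c.
move: (derive_within `[a, b] d) d2E H1 H2 => e d2E H1 H2 {d2c}.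
have m1 := normr_ge0 (e y1); have m2 := normr_ge0 (e y2).
exists (`|e y1| + `|e y2|) => [|u v]; first by rewrite addr_ge0.
wlog uv : u v / u < v.
  move=> H uI vI; case: (ltgtP u v) => uv; first exact: H.
    by rewrite distrC [`|u - v|]distrC; exact: H.
  by rewrite uv !subrr normr0 mulr0.
move=> uI vI; have au : a <= u by lra. have vb : v <= b by lra.
have dE y : y \in `]u, v[ -> is_derive y 1 d (e y).
  by rewrite in_itv /= => yI; apply: d2E; lra.
have [y] := MVT uv dE (subsegment_continuous branch_der_continuous au vb).
rewrite in_itv /= => yI E; rewrite distrC E [`|u - v|]distrC normrM ler_wpM2r//.
have yab : y \in `[a, b] by rewrite in_itv /=; lra.
have h1 := H1 y yab; have h2 := H2 y yab.
have := ler_norm (e y1); have := ler_norm (- e y2); rewrite normrN.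
by rewrite ler_norml; lra.
Qed.

(** The strict inequality in the interior passes to the limit at the end points. *)
Lemma branch_der_ge1 y : a <= y <= b -> 1 <= d y.
Proof.
move=> yI; have [L L0 HL] := branch_der_lip.
rewrite leNgt; apply/negP => d1; have ab' := ab.
pose t := Num.min ((1 - d y) / (2 * (L + 1))) ((b - a) / 4).
have t0 : 0 < t by rewrite lt_min !divr_gt0//; lra.
have tL : t * (L + 1) <= (1 - d y) / 2.
  have : t <= (1 - d y) / (2 * (L + 1)) by rewrite ge_min lexx.
  by rewrite ler_pdivlMr; lra.
have tb : t <= (b - a) / 4 by rewrite ge_min lexx orbT.
have [z zI yz] : exists2 z, a < z < b & `|y - z| <= t.
  case: (leP y ((a + b) / 2)) => h; [exists (y + t)|exists (y - t)]; try lra.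
    by rewrite (_ : y - (y + t) = - t) ?normrN ?gtr0_norm//; lra.
  by rewrite (_ : y - (y - t) = t) ?gtr0_norm//; lra.
have zI' : a <= z <= b by lra.
have := HL y z yI zI'; have := d_gt1 zI.
have := ler_wpM2l L0 yz; rewrite ler_norml; lra.
Qed.

(** Clamping makes the inverse branch continuous on the whole line. *)
Definition inv_branch (x : R) : R :=
  xget a [set y | a <= y <= b /\ f y = Num.max 0 (Num.min 1 x)].

Definition inv_branch_der x := (d (inv_branch x))^-1.

Let l := inv_branch.

Lemma clamp01 (x : R) : 0 <= Num.max 0 (Num.min 1 x) <= 1.
Proof. by rewrite le_max lexx ge_max ler01 ge_min lexx. Qed.

Lemma clamp_id (x : R) : 0 <= x <= 1 -> Num.max 0 (Num.min 1 x) = x.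
Proof. by move=> /andP[x0 x1]; rewrite (min_idPr x1) (max_idPr x0). Qed.

Lemma inv_branchP x : a <= l x <= b /\ f (l x) = Num.max 0 (Num.min 1 x).
Proof.
have [y yI e] := branch_surj (clamp01 x).
have H : exists y, [set y | a <= y <= b /\ f y = Num.max 0 (Num.min 1 x)] y.
  by exists y.
exact: (xgetPex _ H).
Qed.

Lemma inv_branch_itv x : a <= l x <= b. Proof. by case: (inv_branchP x). Qed.

Lemma inv_branchK x : 0 <= x <= 1 -> f (l x) = x.
Proof. by move=> xI; case: (inv_branchP x) => _ ->; rewrite clamp_id. Qed.

Lemma branchK y : a <= y <= b -> l (f y) = y.
Proof.
move=> yI; have e := inv_branchK (branch_image yI); have lI := inv_branch_itv (f y).
apply/eqP; rewrite eq_le; apply/andP; split; rewrite leNgt; apply/negP => h.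
  by have := @branch_expand y (l (f y)); lra.
by have := @branch_expand (l (f y)) y; lra.
Qed.

Lemma inv_branch_0 : l 0 = a.
Proof. by rewrite -branch_a branchK// lexx ltW. Qed.

Lemma inv_branch_1 : l 1 = b.
Proof. by rewrite -branch_b branchK// lexx andbT ltW. Qed.

Lemma inv_branch_lip x y : `|l x - l y| <= `|x - y|.
Proof.
have H u v : u <= v -> `|l u - l v| <= `|u - v|.
  move=> uv; have [lu eu] := inv_branchP u; have [lv ev] := inv_branchP v.
  have cl : 0 <= Num.max 0 (Num.min 1 v) - Num.max 0 (Num.min 1 u) <= v - u.
    have C (w : R) : Num.max 0 (Num.min 1 w) = if w < 0 then 0 else if 1 < w then 1 else w.
      have [w0|] := boolP (w < 0); first by rewrite min_r ?max_l//; lra.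
      rewrite -leNgt => w0; have [w1|] := boolP (1 < w); first by rewrite min_l ?max_r; lra.
      by rewrite -leNgt => w1; rewrite min_r ?max_r.
    by rewrite !C; do ! case: ifP => ?; lra.
  have [h|h] := leP (l u) (l v).
    have := @branch_expand (l u) (l v); rewrite eu ev => h'.
    by rewrite distrC [`|u - v|]distrC !ger0_norm; lra.
  by have := @branch_expand (l v) (l u); rewrite eu ev; lra.
by case/orP: (le_total x y) => xy; [exact: H|rewrite distrC [`|x - y|]distrC; exact: H].
Qed.

Lemma inv_branch_continuous x : {for x, continuous l}.
Proof.
apply: (@lipschitz_continuous _ _ 1) => // u v; rewrite mul1r; exact: inv_branch_lip.
Qed.

Lemma inv_branch_der_gt0 x : 0 < inv_branch_der x.
Proof.
by rewrite invr_gt0; have := branch_der_ge1 (inv_branch_itv x); rewrite -/l; lra.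
Qed.

Lemma inv_branch_der_continuous x : {for x, continuous inv_branch_der}.
Proof.
apply: continuousV.
  by rewrite gt_eqF//; have := branch_der_ge1 (inv_branch_itv x); lra.
have [L L0 HL] := branch_der_lip.
apply: (@lipschitz_continuous _ _ L) => // u v.
apply: le_trans (HL _ _ (inv_branch_itv u) (inv_branch_itv v)) _.
by rewrite ler_wpM2l// inv_branch_lip.
Qed.

Lemma inv_branch_in x : 0 < x < 1 -> a < l x < b.
Proof.
move=> xI; have lI := inv_branch_itv x; have e := @inv_branchK x.
have := branch_a; have := branch_b.
rewrite !lt_neqAle eq_sym; case/andP: lI => -> ->; rewrite !andbT.
move=> fb fa; apply/andP; split; apply/eqP => h; move: e; rewrite h ?fa ?fb; lra.
Qed.

Lemma inv_branch_is_derive (x : R) : 0 < x < 1 -> is_derive x 1 l (inv_branch_der x).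
Proof.
move=> xI; have lI := inv_branch_in xI.
have xE : f (l x) = x by apply: inv_branchK; lra.
rewrite -{1}xE; apply: is_derive_inverse.
- by apply: filterS (segment_nbhs lI) => y; rewrite /= in_itv /= => /branchK.
- have := @near_in_itvoo R a b (l x); rewrite in_itv => /(_ lI).
  apply: filterS => y; rewrite in_itv /= => /branch_is_derive.
  by case=> df _; exact/differentiable_continuous/derivable1_diffP.
- exact: branch_is_derive.
- by rewrite gt_eqF//; have := d_gt1 lI; lra.
Qed.

Lemma inv_branch_der_lt1 x : 0 < x < 1 -> inv_branch_der x < 1.
Proof.
by move=> xI; rewrite invf_lt1; have := d_gt1 (inv_branch_in xI); rewrite -/l; lra.
Qed.

(** The derivative is Lipschitz and at least 1, so its logarithm is Lipschitz. *)
Lemma inv_branch_distortion : exists2 L, 0 <= L & forall x y,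
  inv_branch_der x <= expR (L * `|l x - l y|) * inv_branch_der y.
Proof.
have [L L0 HL] := branch_der_lip; exists L => // x y.
have dx := branch_der_ge1 (inv_branch_itv x).
have dy := branch_der_ge1 (inv_branch_itv y).
rewrite ler_pdivlMr; last by lra.
rewrite mulrC ler_pdivrMr; last by lra.
have := HL _ _ (inv_branch_itv x) (inv_branch_itv y).
have := expR_ge1Dx (L * `|l x - l y|); rewrite -/l in dx dy *.
have := ler_wpM2l (mulr_ge0 L0 (normr_ge0 (l x - l y))) dx.
rewrite ler_norml; move: (expR _) => E.
set T := L * _ => h1 h2 h3.
have := ler_wpM2r (_ : 0 <= d (l x)) h2; lra.
Qed.

Lemma branch_quotient p (u : nat -> R) : a <= p <= b ->
  (forall n, a <= u n <= b) -> (forall n, u n != p) -> u @ \oo --> p ->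
  (f (u n) - f p) / (u n - p) @[n --> \oo] --> d p.
Proof.
move=> pI uI up ucv; apply/cvgrPdist_lt => e e0.
have [r r0 Hr] := derivable_withinP (branch_derivable pI) e0.
move/cvgrPdist_lt/(_ _ r0) : ucv; apply: filterS => n un.
by apply: Hr => //=; rewrite in_itv /=; exact: uI.
Qed.

End inverse_branch.

(** * Orbits near a neutral fixed point *)

Section neutral_fixed_point.
Variable R : realType.

Lemma is_derive_seq (f : R -> R) (x d : R) (v : nat -> R) : is_derive x 1 f d ->
  (forall n, v n != 0) -> v @ \oo --> (0 : R) ->
  (v n)^-1 * (f (v n + x) - f x) @[n --> \oo] --> d.
Proof.
case=> df <- v0 vcv.
have /cvgr_dnbhsP H : (fun h => h^-1 *: (f (h *: 1 + x) - f x)) @ 0^' --> 'D_1 f x.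
  exact: df.
have := H v (conj v0 vcv); rewrite /GRing.scale /=.
by under eq_fun do rewrite mulr1.
Qed.

(** Near a neutral fixed point the variable [y `^ - s] linearizes the dynamics: it
    grows by [b * s] at each step, up to an error that averages out. *)
Lemma neutral_orbit_growth (s b : R) (y : nat -> R) : 0 < s -> 0 < b ->
  (forall n, 0 < y n) -> (forall n, y n.+1 < y n) -> y @ \oo --> (0 : R) ->
  (y n - y n.+1) / (b * y n.+1 `^ (1 + s)) @[n --> \oo] --> (1 : R) ->
  n.+1%:R^-1 * y n.+1 `^ (- s) @[n --> \oo] --> b * s.
Proof.
move=> s0 b0 y0 yS ycv rcv.
pose r n := (y n - y n.+1) / (b * y n.+1 `^ (1 + s)).
pose v n := (y n - y n.+1) / y n.+1.
pose t n := y n `^ (- s).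
have vE n : v n = r n * (b * y n.+1 `^ s).
  rewrite /v /r powRD; last by rewrite (gt_eqF (y0 _)) implybT.
  rewrite powRr1; last exact: ltW.
  by field; rewrite !gt_eqF// powR_gt0.
have v0 n : 0 < v n by rewrite divr_gt0// subr_gt0.
have yScv : y n.+1 @[n --> \oo] --> (0 : R) by rewrite (cvg_shiftS y).
have yscv : y n.+1 `^ s @[n --> \oo] --> (0 : R).
  have /cvg_at_rightP := powR_cvg0 s0.
  by apply; split => // n; exact: y0.
have vcv : v @ \oo --> (0 : R).
  rewrite (_ : v = fun n => r n * (b * y n.+1 `^ s)); last exact/funext.
  rewrite -[X in _ --> X](mulr0 (1 * b)) -mulrA.
  by apply: cvgM => //; apply: cvgM => //; exact: cvg_cst.
have dcv : (v n)^-1 * ((v n + 1) `^ (- s) - 1) @[n --> \oo] --> - s.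
  have d1 := is_derive1_powR (- s) (@ltr01 R); rewrite powR1 mulr1 in d1.
  have := is_derive_seq d1 (fun n => lt0r_neq0 (v0 n)) vcv.
  by rewrite powR1.
have tcv : t n.+1 - t n @[n --> \oo] --> b * s.
  rewrite (_ : (fun n => _) = fun n =>
      - (r n * b * ((v n)^-1 * ((v n + 1) `^ (- s) - 1)))); last first.
    apply/funext => n; rewrite /t.
    have -> : y n = y n.+1 * (v n + 1) by rewrite /v; field; rewrite gt_eqF.
    have ys0 : 0 < y n.+1 `^ s by rewrite powR_gt0.
    rewrite powRM; [|exact: ltW|by rewrite addr_ge0// ltW].
    rewrite (_ : r n * b = v n * y n.+1 `^ (- s)); last first.
      by rewrite vE powRN mulrA mulfK// gt_eqF.
    by field; rewrite gt_eqF.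
  rewrite (_ : b * s = - (1 * b * - s)); last by ring.
  by apply: cvgN; apply: cvgM => //; apply: cvgM => //; exact: cvg_cst.
have cvm := cesaro tcv.
have cvt0 : n.+1%:R^-1 * t 0 @[n --> \oo] --> (0 : R).
  rewrite -(mul0r (t 0)); apply: cvgM; last exact: cvg_cst.
  exact: cvg_harmonic.
have H := cvgD cvm cvt0; rewrite addr0 in H.
suff -> : (fun n => n.+1%:R^-1 * t n.+1) =
    (fun n => arithmetic_mean (telescope t) n + n.+1%:R^-1 * t 0) by exact: H.
apply/funext => n; rewrite /arithmetic_mean /= -mulrDr; congr (_ * _).
by rewrite telescopeK /= subrK.
Qed.

(** Both orbits are of the order of [n `^ (- s^-1)]. *)
Lemma neutral_orbits_ratio (s b b' : R) (y y' : nat -> R) :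
  0 < s -> 0 < b -> 0 < b' -> (forall n, 0 < y n) -> (forall n, 0 < y' n) ->
  n.+1%:R^-1 * y n.+1 `^ (- s) @[n --> \oo] --> b * s ->
  n.+1%:R^-1 * y' n.+1 `^ (- s) @[n --> \oo] --> b' * s ->
  y n / y' n @[n --> \oo] --> (b' / b) `^ s^-1.
Proof.
move=> s0 b0 b0' y0 y0' cy cy'.
rewrite -(cvg_shiftS (fun n => y n / y' n)).
rewrite (_ : (fun n => _) = fun n => ((n.+1%:R^-1 * y' n.+1 `^ (- s)) /
   (n.+1%:R^-1 * y n.+1 `^ (- s))) `^ s^-1); last first.
  apply/funext => n /=.
  have n0 : 0 < n.+1%:R :> R by rewrite ltr0n.
  have ys := powR_gt0 s (y0 n.+1); have ys' := powR_gt0 s (y0' n.+1).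
  rewrite (_ : _ / _ = (y n.+1 / y' n.+1) `^ s).
    by rewrite -powRrM mulfV ?gt_eqF// powRr1// ltW// divr_gt0.
  rewrite powRM ?invr_ge0 ?(ltW (y0 _)) ?(ltW (y0' _))//.
  rewrite -[(y' n.+1)^-1]powR_inv1 ?(ltW (y0' _))// -powRrM mulN1r !powRN.
  by field; rewrite !gt_eqF.
have bs0 : b * s != 0 by rewrite gt_eqF// mulr_gt0.
have q0 : 0 < b' / b by rewrite divr_gt0.
have cq : (n.+1%:R^-1 * y' n.+1 `^ (- s)) / (n.+1%:R^-1 * y n.+1 `^ (- s))
    @[n --> \oo] --> b' / b.
  have -> : b' / b = b' * s * (b * s)^-1 by field; rewrite !gt_eqF.
  by apply: cvgM => //; exact: cvgV.
exact: (cvg_comp _ (fun x : R => x `^ s^-1) cq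
  (is_derive_continuous (is_derive1_powR s^-1 q0))).
Qed.

(** As [1 <= s], the orbit decreases no faster than a multiple of [1 / n]. *)
Lemma neutral_orbit_dvg (s b : R) (y : nat -> R) : 1 <= s -> 0 < b ->
  (forall n, 0 < y n <= 1) ->
  n.+1%:R^-1 * y n.+1 `^ (- s) @[n --> \oo] --> b * s ->
  forall A, exists k, A <= \sum_(i < k) y i.
Proof.
move=> s1 b0 y01 cy A.
have s0 : 0 < s by lra.
have bs0 : 0 < b * s by rewrite mulr_gt0.
have /cvgrPdist_lt/(_ _ bs0)[N _ HN] := cy.
pose B := 2 * (b * s).
have B0 : 0 < B by rewrite /B; lra.
have yl n : (N <= n)%N -> B^-1 * harmonic n <= y n.+1.
  move=> /HN /=; rewrite ltr_norml => /andP[h _].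
  have n0 : 0 < n.+1%:R :> R by rewrite ltr0n.
  have /andP[p0 p1] := y01 n.+1.
  have : n.+1%:R^-1 * y n.+1 `^ (- s) < B.
    by rewrite /B; move: (_^-1 * _) h => X h; lra.
  have : (y n.+1)^-1 <= y n.+1 `^ (- s).
    rewrite powRN lef_pV2 ?posrE ?powR_gt0//.
    by apply: ge1r_powR; rewrite ?p0.
  move=> h1; rewrite mulrC ltr_pdivrMr// => h2.
  rewrite -invfM -[leRHS]invrK lef_pV2 ?posrE ?invr_gt0 ?mulr_gt0//.
  by rewrite ltW// (le_lt_trans h1).
have unb : exists k, (A - 0) * B + series harmonic N <= series (@harmonic R) k.
  apply: contrapT => nex; apply: (@dvg_harmonic R).
  apply: nondecreasing_is_cvgn.
    by apply/nondecreasing_seqP => n; rewrite seriesSr lerDl invr_ge0.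
  exists ((A - 0) * B + series harmonic N) => _ [k _ <-].
  by rewrite leNgt; apply/negP => h; apply: nex; exists k; exact: ltW.
have [k hk] := unb.
have ser m : series harmonic (N + m)%N <= series harmonic N +
    B * \sum_(i < (N + m).+1) y i.
  elim: m => [|m IH].
    by rewrite addn0 lerDl mulr_ge0 ?(ltW B0)// sumr_ge0// => i _; case/andP: (y01 i) => /ltW.
  rewrite addnS seriesSr big_ord_recr /= mulrDr addrA lerD//.
  by rewrite -ler_pdivrMl// yl// leq_addr.
exists (N + k).+1%N; rewrite -(ler_pM2l B0).
have : series harmonic k <= series (@harmonic R) (N + k)%N.
  elim: N {HN yl unb hk ser} => //= N' IH.
  by apply: le_trans IH _; rewrite addSn seriesSr lerDl invr_ge0.
have := ser k; rewrite subr0 in hk; lra.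
Qed.

End neutral_fixed_point.

(** * The inverse branches of a map with two neutral fixed points *)

Section neutral_map.
Variables (R : realType) (alpha b1 b2 c : R) (f fl fr : R -> R).
Hypothesis alpha01 : 0 < alpha <= 1.
Hypotheses (b1_gt0 : 0 < b1) (b2_gt0 : 0 < b2) (c01 : 0 < c < 1).
Hypotheses (fl_C2 : C2_on `[0, c] fl) (fr_C2 : C2_on `[c, 1] fr).
Hypotheses (flE : {in `]0, c[, fl =1 f}) (frE : {in `]c, 1[, fr =1 f}).
Hypotheses (fl_img : fl @` `[0, c] = `[0, 1]%classic)
           (fr_img : fr @` `[c, 1] = `[0, 1]%classic).
Hypothesis df_gt1 : forall x : R, 0 < x < 1 -> x != c -> 1 < derive1 f x.
Hypothesis f_asymp0 :
  (f x - x) / (b1 * x `^ (1 + alpha^-1)) @[x --> 0^'+] --> (1 : R).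
Hypothesis f_asymp1 :
  (x - f x) / (b2 * (1 - x) `^ (1 + alpha^-1)) @[x --> 1^'-] --> (1 : R).

Lemma extension_der_gt1 (h : R -> R) a b : a < b -> 0 <= a -> b <= 1 ->
  ~~ (a < c < b) -> C2_on `[a, b] h -> {in `]a, b[, h =1 f} ->
  forall y, a < y < b -> 1 < derive_within `[a, b] h y.
Proof.
move=> ab a0 b1' nc h2 hf y yI.
have dh := branch_is_derive h2 yI.
have dfh : is_derive y 1 f (derive_within `[a, b] h y).
  have near_hf : \forall z \near y, h z = f z.
    have := @near_in_itvoo R a b y; rewrite in_itv => /(_ yI).
    by apply: filterS => z; exact: hf.
  exact: near_eq_is_derive near_hf dh.
have -> : derive_within `[a, b] h y = derive1 f y.
  by rewrite derive1E; case: dfh => _ ->.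
apply: df_gt1; first lra.
by apply: contra nc => /eqP <-.
Qed.

Let dl_gt1 : forall y, 0 < y < c -> 1 < derive_within `[0, c] fl y.
Proof.
have /andP[c0 c1] := c01.
by apply: (extension_der_gt1 c0 (lexx 0) (ltW c1) _ fl_C2 flE); rewrite ltxx andbF.
Qed.

Let dr_gt1 : forall y, c < y < 1 -> 1 < derive_within `[c, 1] fr y.
Proof.
have /andP[c0 c1] := c01.
by apply: (extension_der_gt1 c1 (ltW c0) (lexx 1) _ fr_C2 frE); rewrite ltxx.
Qed.

Definition f_inv b := if b then inv_branch c 1 fr else inv_branch 0 c fl.
Definition f_inv_der b :=
  if b then inv_branch_der c 1 fr else inv_branch_der 0 c fl.

Arguments f_inv : simpl never.
Arguments f_inv_der : simpl never.

Let c0 : 0 < c. Proof. by case/andP: c01. Qed.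
Let c1 : c < 1. Proof. by case/andP: c01. Qed.

Lemma f_inv_0 b : f_inv b 0 = if b then c else 0.
Proof.
case: b; [exact: (inv_branch_0 c1 fr_C2 fr_img dr_gt1)|
  exact: (inv_branch_0 c0 fl_C2 fl_img dl_gt1)].
Qed.

Lemma f_inv_1 b : f_inv b 1 = if b then 1 else c.
Proof.
case: b; [exact: (inv_branch_1 c1 fr_C2 fr_img dr_gt1)|
  exact: (inv_branch_1 c0 fl_C2 fl_img dl_gt1)].
Qed.

Lemma f_inv_continuous b x : {for x, continuous (f_inv b)}.
Proof.
case: b; [exact: (inv_branch_continuous fr_C2 fr_img dr_gt1)|
  exact: (inv_branch_continuous fl_C2 fl_img dl_gt1)].
Qed.

Lemma f_inv_der_continuous b x : {for x, continuous (f_inv_der b)}.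
Proof.
case: b; [exact: (inv_branch_der_continuous c1 fr_C2 fr_img dr_gt1)|
  exact: (inv_branch_der_continuous c0 fl_C2 fl_img dl_gt1)].
Qed.

Lemma f_inv_is_derive b (x : R) : 0 < x < 1 -> is_derive x 1 (f_inv b) (f_inv_der b x).
Proof.
move=> xI; case: b; [exact: (inv_branch_is_derive fr_C2 fr_img dr_gt1 xI)|
  exact: (inv_branch_is_derive fl_C2 fl_img dl_gt1 xI)].
Qed.

Lemma f_inv_der_gt0 b x : 0 < f_inv_der b x.
Proof.
case: b; [exact: (inv_branch_der_gt0 c1 fr_C2 fr_img dr_gt1 x)|
  exact: (inv_branch_der_gt0 c0 fl_C2 fl_img dl_gt1 x)].
Qed.

Lemma f_inv_der_lt1 b x : 0 < x < 1 -> f_inv_der b x < 1.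
Proof.
move=> xI; case: b; [exact: (inv_branch_der_lt1 fr_C2 fr_img dr_gt1 xI)|
  exact: (inv_branch_der_lt1 fl_C2 fl_img dl_gt1 xI)].
Qed.

Lemma f_inv_distortion : exists2 D, 0 <= D & forall b x y, 0 < x < 1 -> 0 < y < 1 ->
  f_inv_der b x <= expR (D * `|f_inv b x - f_inv b y|) * f_inv_der b y.
Proof.
have [L1 L10 H1] := inv_branch_distortion c0 fl_C2 fl_img dl_gt1.
have [L2 L20 H2] := inv_branch_distortion c1 fr_C2 fr_img dr_gt1.
exists (L1 + L2) => [|b x y _ _]; first by rewrite addr_ge0.
case: b; [apply: le_trans (H2 x y) _|apply: le_trans (H1 x y) _];
  rewrite ler_wpM2r ?ler_expR ?ler_wpM2r ?lerDl ?lerDr//; apply: ltW.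
  exact: (inv_branch_der_gt0 c1 fr_C2 fr_img dr_gt1).
exact: (inv_branch_der_gt0 c0 fl_C2 fl_img dl_gt1).
Qed.

Lemma f_inv_branches : exists D, inverse_branches c D f_inv f_inv_der.
Proof.
have [D D0 HD] := f_inv_distortion; exists D; split => //.
- exact: f_inv_continuous.
- exact: f_inv_der_continuous.
- exact: f_inv_is_derive.
- exact: f_inv_der_gt0.
- exact: f_inv_der_lt1.
- exact: f_inv_0.
- exact: f_inv_1.
Qed.

Let y n := iter n (f_inv false) c.
Let z n := 1 - iter n (f_inv true) c.

Lemma f_inv_left_in (x : R) : 0 < x < 1 -> 0 < f_inv false x < c.
Proof. exact: (inv_branch_in fl_C2 fl_img dl_gt1). Qed.

Lemma f_inv_right_in (x : R) : 0 < x < 1 -> c < f_inv true x < 1.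
Proof. exact: (inv_branch_in fr_C2 fr_img dr_gt1). Qed.

Lemma f_invK b (x : R) : 0 < x < 1 -> f (f_inv b x) = x.
Proof.
move=> xI; have xI' : 0 <= x <= 1 by lra.
case: b; rewrite /f_inv.
  rewrite -frE ?(inv_branchK fr_img)//.
  by rewrite in_itv /=; exact: f_inv_right_in.
rewrite -flE ?(inv_branchK fl_img)//.
by rewrite in_itv /=; exact: f_inv_left_in.
Qed.

Let s := alpha^-1.
Let s_ge1 : 1 <= s. Proof. by rewrite invf_ge1; case/andP: alpha01. Qed.
Let s_gt0 : 0 < s. Proof. exact: lt_le_trans s_ge1. Qed.

Lemma left_orbit_growth : n.+1%:R^-1 * y n.+1 `^ (- s) @[n --> \oo] --> b1 * s.
Proof.
have [D gB] := f_inv_branches.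
have yI n : 0 < y n < 1 by exact: iter_g01 gB _ _ _ _.
have y_gt0 n : 0 < y n by case/andP: (yI n).
have ycv : y @ \oo --> (0 : R) := iter_false_cvg0 gB.
apply: neutral_orbit_growth => // [n|].
  by have := g_sign gB false (yI n); rewrite expr0 mul1r subr_gt0.
have e n : f (y n.+1) = y n by exact: f_invK.
have -> : (fun n => (y n - y n.+1) / (b1 * y n.+1 `^ (1 + s))) =
    (fun n => (f (y n.+1) - y n.+1) / (b1 * y n.+1 `^ (1 + s))).
  by apply/funext => n; rewrite e.
move/cvg_at_rightP: f_asymp0; apply.
by split => [n|]; [exact: y_gt0|rewrite (cvg_shiftS y)].
Qed.

Let z_cvg : z @ \oo --> (0 : R).
Proof.
have [D gB] := f_inv_branches.
rewrite -[0](subrr 1); apply: cvgB; first exact: cvg_cst.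
exact: iter_true_cvg1 gB.
Qed.

Lemma right_orbit_growth : n.+1%:R^-1 * z n.+1 `^ (- s) @[n --> \oo] --> b2 * s.
Proof.
have [D gB] := f_inv_branches.
pose x n := iter n (f_inv true) c.
have xI n : 0 < x n < 1 by exact: iter_g01 gB _ _ _ _.
apply: neutral_orbit_growth => // [n|n|].
- by have := xI n; rewrite /z -/(x n); lra.
- rewrite -[z n.+1]/(1 - f_inv true (x n)) -[z n]/(1 - x n).
  by have := g_sign gB true (xI n); rewrite expr1; lra.
have e n : f (x n.+1) = x n by exact: f_invK.
have -> : (fun n => (z n - z n.+1) / (b2 * z n.+1 `^ (1 + s))) =
    (fun n => (x n.+1 - f (x n.+1)) / (b2 * (1 - x n.+1) `^ (1 + s))).
  by apply/funext => n; rewrite e /z -!/(x _); congr (_ / _); lra.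
move/cvg_at_leftP: f_asymp1; apply; split => [n|].
  by case/andP: (xI n.+1).
by rewrite (cvg_shiftS x); exact: iter_true_cvg1 gB.
Qed.

Let dl := derive_within `[0, c] fl c.
Let dr := derive_within `[c, 1] fr c.

Let dl_gt0 : 0 < dl.
Proof.
apply: lt_le_trans ltr01 _; apply: (branch_der_ge1 c0 fl_C2 dl_gt1).
by rewrite lexx ltW.
Qed.

Let dr_gt0 : 0 < dr.
Proof.
apply: lt_le_trans ltr01 _; apply: (branch_der_ge1 c1 fr_C2 dr_gt1).
by rewrite lexx ltW.
Qed.

(** The right branch sends [c] to 0 and [c + gap_right n] to [y n]. *)
Lemma gap_right_quotient : y n / gap_right c f_inv n @[n --> \oo] --> dr.
Proof.
have [D gB] := f_inv_branches.
have yI n : 0 < y n < 1 by exact: iter_g01 gB _ _ _ _.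
pose u n := f_inv true (y n).
have uI n : c < u n < 1 by exact: f_inv_right_in.
have ucv : u @ \oo --> c.
  have := cvg_comp _ _ (iter_false_cvg0 gB) (@f_inv_continuous true 0).
  by rewrite f_inv_0.
have := @branch_quotient _ _ _ _ fr_C2 c u; rewrite -/dr.
rewrite (branch_a fr_C2 fr_img dr_gt1).
rewrite (_ : (fun n => _) = fun n => y n / gap_right c f_inv n); last first.
  apply/funext => n; rewrite subr0 /gap_right -/(y n) -/(u n).
  by rewrite /u /f_inv (inv_branchK fr_img)//; have := yI n; lra.
apply => // [|n|n].
- by rewrite lexx ltW.
- by have := uI n; lra.
- by rewrite gt_eqF//; case/andP: (uI n).
Qed.

Lemma gap_left_quotient : z n / gap_left c f_inv n @[n --> \oo] --> dl.
Proof.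
have [D gB] := f_inv_branches.
pose x n := iter n (f_inv true) c.
have xI n : 0 < x n < 1 by exact: iter_g01 gB _ _ _ _.
pose u n := f_inv false (x n).
have uI n : 0 < u n < c by exact: f_inv_left_in.
have ucv : u @ \oo --> c.
  have := cvg_comp _ _ (iter_true_cvg1 gB) (@f_inv_continuous false 1).
  by rewrite f_inv_1.
have := @branch_quotient _ _ _ _ fl_C2 c u; rewrite -/dl.
rewrite (branch_b fl_C2 fl_img dl_gt1).
rewrite (_ : (fun n => _) = fun n => z n / gap_left c f_inv n); last first.
  apply/funext => n; rewrite /gap_left /z -!/(x n) -/(u n).
  have -> : fl (u n) = x n by rewrite /u /f_inv (inv_branchK fl_img)//; have := xI n; lra.
  by field; have /andP[_ uc] := uI n; rewrite !subr_eq0 gt_eqF// lt_eqF.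
apply => // [|n|n].
- by rewrite lexx ltW.
- by have := uI n; lra.
- by rewrite lt_eqF//; case/andP: (uI n).
Qed.

(** The power comes from the speed of the orbits at the neutral fixed points, the
    derivatives from the transport of these orbits to both sides of [c]. *)
Definition entry_ratio := (b2 / b1) `^ alpha * dl / dr.

Lemma entry_ratio_gt0 : 0 < entry_ratio.
Proof. by rewrite divr_gt0// mulr_gt0// powR_gt0// divr_gt0. Qed.

Lemma gap_ratio_cvg :
  gap_right c f_inv n / gap_left c f_inv n @[n --> \oo] --> entry_ratio.
Proof.
have [D gB] := f_inv_branches.
have y_gt0 n : 0 < y n by case/andP: (iter_g01 gB false n (ib_c gB)).
have z_gt0 n : 0 < z n by rewrite subr_gt0; case/andP: (iter_g01 gB true n (ib_c gB)).
have cr := neutral_orbits_ratio s_gt0 b1_gt0 b2_gt0 y_gt0 z_gt0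
  left_orbit_growth right_orbit_growth.
rewrite /s invrK in cr.
rewrite (_ : (fun n => _) = fun n => (y n / z n) * (z n / gap_left c f_inv n) /
    (y n / gap_right c f_inv n)); last first.
  apply/funext => n; field.
  by rewrite !gt_eqF ?(gap_left_gt0 gB) ?(gap_right_gt0 gB).
apply: cvgM; first by apply: cvgM => //; exact: gap_left_quotient.
by apply: cvgV; [rewrite gt_eqF|exact: gap_right_quotient].
Qed.

(** The gaps are comparable to an orbit near the neutral fixed point 0. *)
Lemma gap_right_sum_dvg A : exists k, A <= \sum_(i < k) gap_right c f_inv i.
Proof.
have [D gB] := f_inv_branches.
have yI n : 0 < y n < 1 by exact: iter_g01 gB _ _ _ _.
have y01 n : 0 < y n <= 1 by have := yI n; lra.
have [L L0 HL] := branch_der_lip c1 fr_C2.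
have B0 : 0 < dr + L by rewrite ltr_pwDl.
have [k Hk] := neutral_orbit_dvg s_ge1 b1_gt0 y01 left_orbit_growth ((dr + L) * A).
exists k; rewrite -(ler_pM2l B0); apply: le_trans Hk _; rewrite mulr_sumr.
apply: ler_sum => i _; have /andP[uc u1] := f_inv_right_in (yI i).
have [t tI e] := branch_mvt fr_C2 (lexx c) uc (ltW u1).
rewrite (branch_a fr_C2 fr_img dr_gt1) subr0 (inv_branchK fr_img) in e; last first.
  by have := yI i; lra.
rewrite e -/(gap_right c f_inv i) ler_wpM2r ?(ltW (gap_right_gt0 gB _))//.
have cp := c0; have cl1 := c1.
have tc : c <= t <= 1 by lra.
have cc : c <= c <= 1 by lra.
have := HL t c tc cc; rewrite -/dr ler_norml => /andP[_ h].
have : L * `|t - c| <= L by rewrite ler_piMr// ler_norml; lra.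
lra.
Qed.

(** The limit proportion depends on the map only, not on the initial density. *)
Lemma cumul_iterates_cvg (rho0 F0 : R -> R) :
  (forall x, {for x, continuous rho0}) -> (forall x, 0 < rho0 x) -> F0 0 = 0 ->
  (forall x : R, 0 <= x <= 1 -> is_derive x 1 F0 (rho0 x)) ->
  forall x, 0 < x < 1 ->
    cumul c f_inv F0 n x @[n --> \oo] --> entry_ratio / (1 + entry_ratio) * F0 1.
Proof.
have [D gB] := f_inv_branches => r_cont r_gt0 F00 F0E x xI.
exact: (cumul_cvg gB r_cont r_gt0 F00 F0E gap_right_sum_dvg entry_ratio_gt0
  gap_ratio_cvg xI).
Qed.

Hypotheses (f0 : f 0 = 0) (f1 : f 1 = 1).

Lemma f_left t : 0 <= t < c -> f t = fl t.
Proof.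
move=> /andP[]; rewrite le_eqVlt => /predU1P[<- _|t0 tc].
  by rewrite f0 (branch_a fl_C2 fl_img dl_gt1).
by rewrite flE// in_itv /= t0.
Qed.

Lemma f_right t : c < t <= 1 -> f t = fr t.
Proof.
move=> /andP[ct]; rewrite le_eqVlt => /predU1P[->|t1].
  by rewrite f1 (branch_b fr_C2 fr_img dr_gt1).
by rewrite frE// in_itv /= ct.
Qed.

Lemma f_below t x : 0 <= t <= 1 -> t != c -> 0 <= x <= 1 ->
  (f t <= x) = (t <= f_inv false x) || (c < t <= f_inv true x).
Proof.
move=> tI tc xI; have c0' := c0; have c1' := c1.
have lI : 0 <= f_inv false x <= c by exact: inv_branch_itv.
have rI : c <= f_inv true x <= 1 by exact: inv_branch_itv.
have le : fl (f_inv false x) = x by exact: inv_branchK.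
have re : fr (f_inv true x) = x by exact: inv_branchK.
have [lt|gt|e] := ltgtP t c; last by rewrite e eqxx in tc.
- rewrite f_left; last by lra.
  rewrite andFb orbF; have [h|h] := leP t (f_inv false x).
    by rewrite -{1}le; apply/idP; apply: (branch_le fl_C2 dl_gt1); lra.
  apply/negbTE; rewrite -ltNge -{1}le.
  by have := @branch_expand _ _ _ _ fl_C2 dl_gt1 (f_inv false x) t; lra.
- rewrite f_right; last by lra.
  rewrite (_ : (t <= f_inv false x) = false) /=; last by apply/negbTE; rewrite -ltNge; lra.
  have [h|h] := leP t (f_inv true x).
    by rewrite -{1}re; apply/idP; apply: (branch_le fr_C2 dr_gt1); lra.
  apply/negbTE; rewrite -ltNge -{1}re.
  by have := @branch_expand _ _ _ _ fr_C2 dr_gt1 (f_inv true x) t; lra.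
Qed.

Lemma f_fiber t : 0 <= t <= 1 -> t != c ->
  t = f_inv false (f t) \/ t = f_inv true (f t).
Proof.
move=> tI tc; have [lt|gt|e] := ltgtP t c; last by rewrite e eqxx in tc.
  left; rewrite f_left; last by lra.
  by rewrite /f_inv (branchK fl_C2 fl_img dl_gt1)//; lra.
right; rewrite f_right; last by lra.
by rewrite /f_inv (branchK fr_C2 fr_img dr_gt1)//; lra.
Qed.

Lemma f_measurable : measurable_fun (`[0, 1]%classic : set (measurableTypeR R))
  (f : measurableTypeR R -> measurableTypeR R).
Proof.
have c0' := c0; have c1' := c1.
have -> : `[0, 1]%classic = `[0, c[ `|` ([set c] `|` `]c, 1]) :> set (measurableTypeR R).
  apply/seteqP; split => t /=; rewrite !in_itv /=.
    by move=> tI; case: (ltgtP t c) => h; [left|right; right|right; left]; lra.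
  by move=> [h|[->|h]]; lra.
have branch_meas (h : R -> R) a b : C2_on `[a, b] h ->
    measurable_fun (`[a, b]%classic : set (measurableTypeR R))
      (h : measurableTypeR R -> measurableTypeR R).
  move=> h2; apply: measurable_realfun.subspace_continuous_measurable_fun => //.
  exact: branch_continuous h2.
apply/measurable_funU => //; first exact: measurableU.
split.
  apply: (@eq_measurable_fun _ _ _ _ _ fl).
    by move=> t; rewrite inE /= in_itv /= => tI; rewrite f_left.
  apply: measurable_funS (branch_meas _ _ _ fl_C2) => //.
  by move=> t /=; rewrite !in_itv /=; lra.
apply/measurable_funU => //; split; first exact: measurable_fun_set1.
apply: (@eq_measurable_fun _ _ _ _ _ fr).
  by move=> t; rewrite inE /= in_itv /= => tI; rewrite f_right.
apply: measurable_funS (branch_meas _ _ _ fr_C2) => //.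
by move=> t /=; rewrite !in_itv /=; lra.
Qed.

End neutral_map.

(** * Images of an absolutely continuous measure *)

Section iterated_measure.
Variables (R : realType) (c D : R) (g dg : bool -> R -> R) (f : R -> R).
Hypothesis gB : inverse_branches c D g dg.
Hypothesis f01 : forall t, 0 <= t <= 1 -> 0 <= f t <= 1.
Hypothesis f_meas : measurable_fun (`[0, 1]%classic : set (measurableTypeR R))
  (f : measurableTypeR R -> measurableTypeR R).
Hypothesis f_below : forall t x, 0 <= t <= 1 -> t != c -> 0 <= x <= 1 ->
  (f t <= x) = (t <= g false x) || (c < t <= g true x).
Hypothesis f_fiber : forall t, 0 <= t <= 1 -> t != c ->
  t = g false (f t) \/ t = g true (f t).

Local Notation mu := (@lebesgue_measure R).
Local Notation I := (`[0%R, 1%R]%classic : set (measurableTypeR R)).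

Definition preiter n (A : set R) : set (measurableTypeR R) :=
  `[0, 1] `&` iter n f @^-1` A.

Lemma iter_f01 n t : 0 <= t <= 1 -> 0 <= iter n f t <= 1.
Proof. by move=> tI; elim: n => //= n IH; exact: f01. Qed.

Lemma iter_f_meas n :
  measurable_fun I (iter n f : measurableTypeR R -> measurableTypeR R).
Proof.
elim: n => [|n IH]; first exact: measurable_id.
rewrite (_ : iter n.+1 f = f \o iter n f); last exact/funext.
apply: (@measurable_comp _ _ _ _ _ _ I) IH => //.
by move=> _ [t /= tI <-]; move: tI; rewrite !in_itv /=; exact: iter_f01.
Qed.

Lemma preiter_measurable n (A : set (measurableTypeR R)) :
  measurable A -> measurable (preiter n A).
Proof. by move=> mA; apply: iter_f_meas. Qed.

Lemma preiter_sub n A : preiter n A `<=` I.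
Proof. exact: subIsetl. Qed.

Lemma preiter_setU n A B : preiter n (A `|` B) = preiter n A `|` preiter n B.
Proof. by rewrite /preiter preimage_setU setIUr. Qed.

(** Away from [c] the map is at most two-to-one. *)
Lemma preiter_finite n x : finite_set (preiter n [set x]).
Proof.
elim: n x => [|n IH] x.
  by apply: sub_finite_set (finite_set1 x) => t [_ /= ->].
have : finite_set (preiter n [set c] `|` (preiter n [set g false x] `|`
    preiter n [set g true x])) by rewrite !finite_setU.
apply: sub_finite_set => t [tI /= e].
have uI := @iter_f01 n t; rewrite /= in_itv /= in tI; have {uI} := uI tI.
set u := iter n f t in e * => uI; have [uc|uc] := eqVneq u c.
  by left; split => //=; rewrite in_itv.
right; have [h|h] := f_fiber uI uc; rewrite e in h; [left|right];
  by split => //=; rewrite in_itv.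
Qed.

Lemma preiter_null n x : mu (preiter n [set x]) = 0%E.
Proof. by apply: countable_lebesgue_measure0; exact/finite_set_countable/preiter_finite. Qed.

Section density.
Variables (rho0 F0 : R -> R).
Hypothesis rho0_cont : forall x, {for x, continuous rho0}.
Hypothesis F0_0 : F0 0 = 0.
Hypothesis F0_der : forall x : R, 0 <= x <= 1 -> is_derive x 1 F0 (rho0 x).

Let J (A : set (measurableTypeR R)) : R := \int[mu]_(t in A) rho0 t.

Let rho0_int : mu.-integrable I (EFin \o rho0).
Proof.
apply: continuous_compact_integrable; first exact: segment_compact.
exact: continuous_subspaceT.
Qed.

Let rho0_intS A : measurable A -> A `<=` I -> mu.-integrable A (EFin \o rho0).
Proof. by move=> mA AI; exact: integrableS rho0_int. Qed.

Let J_disj A B : measurable A -> measurable B -> A `<=` I -> B `<=` I ->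
  [disjoint A & B] -> J (A `|` B) = J A + J B.
Proof.
move=> mA mB AI BI AB; apply: Rintegral_setU => //.
by apply: rho0_intS; [exact: measurableU|rewrite subUset].
Qed.

Let J_null A : measurable A -> A `<=` I -> mu A = 0%E -> J A = 0.
Proof.
move=> mA AI A0; rewrite /J /Rintegral null_set_integral//.
exact: measurable_int (rho0_intS mA AI).
Qed.

Let J_diff A Z : measurable A -> measurable Z -> A `<=` I -> mu Z = 0%E ->
  J (A `\` Z) = J A.
Proof.
move=> mA mZ AI Z0; have mAZ : measurable (A `&` Z) by exact: measurableI.
have AZ0 : mu (A `&` Z) = 0%E.
  by apply: subset_measure0 Z0 => //; exact: subIsetr.
have mD : measurable (A `\` Z) by exact: measurableD.
have sI : A `&` Z `<=` I by move=> t [/AI].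
have sD : A `\` Z `<=` I by move=> t [/AI].
have dj : [disjoint A `&` Z & A `\` Z] by apply/disj_setPS => t [[_ Zt] [_ /(_ Zt)]].
by rewrite -[in RHS](setUIDK A Z) (J_disj mAZ mD sI sD dj) (J_null mAZ sI AZ0) add0r.
Qed.

Let J_ae A B Z : measurable A -> measurable B -> measurable Z ->
  A `<=` I -> B `<=` I -> mu Z = 0%E -> A `\` Z = B `\` Z -> J A = J B.
Proof.
by move=> mA mB mZ AI BI Z0 e; rewrite -(J_diff mA mZ AI Z0) e J_diff.
Qed.

Lemma preiter0_cumul x : 0 <= x <= 1 -> J (preiter 0 `[0, x]) = F0 x.
Proof.
move=> /andP[x0 x1].
have -> : preiter 0 `[0, x] = `[0, x]%classic.
  rewrite /preiter; apply/seteqP; split => [t []//|t /=].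
  by rewrite !in_itv /=; lra.
move: x0; rewrite le_eqVlt => /predU1P[<-|x0].
  rewrite F0_0 J_null ?set_itv1 ?lebesgue_measure_set1// => t /= ->.
  by rewrite in_itv /= lexx ler01.
have F0c : {within `[0, x], continuous F0}.
  apply: continuous_in_subspaceT => t; rewrite inE /= in_itv /= => tI.
  by apply: is_derive_continuous (F0_der _); lra.
rewrite /J /Rintegral (@continuous_FTC2 _ rho0 F0)//.
- by rewrite F0_0 sube0.
- exact: continuous_subspaceT.
- have [_ ? ?] := (continuous_within_itvP F0 x0).1 F0c; split => // t.
  by rewrite in_itv /= => tI; have [] : is_derive t 1 F0 (rho0 t) by apply: F0_der; lra.
- move=> t; rewrite in_itv /= => tI; rewrite derive1E.
  by have [_ ->] : is_derive t 1 F0 (rho0 t) by apply: F0_der; lra.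
Qed.

(** The value of the map at [c] is arbitrary, but this only matters on the
    preimages of [c], which form a null set. *)
Lemma preiter_cumul n x : 0 <= x <= 1 -> J (preiter n `[0, x]) = cumul c g F0 n x.
Proof.
elim: n x => [|n IH] x xI; first exact: preiter0_cumul.
have cI := ib_c gB; have /andP[c0 c1] := cI.
have lI := g01w gB false xI; have rI := g01w gB true xI.
have crx : c <= g true x.
  by rewrite -[X in X <= _](ib_0 gB true) (g_le gB)//; lra.
have mP := preiter_measurable.
have split_r : J (preiter n `[0, g true x]) =
    J (preiter n `[0, c]) + J (preiter n `]c, g true x]).
  rewrite -J_disj; try by [exact: mP|exact: preiter_sub].
    rewrite -preiter_setU; congr (J (preiter n _)).
    by apply/seteqP; split => t /=; rewrite !in_itv /=; [case: (leP t c); lra|lra].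
  apply/disj_setPS => t [[_ h1] [_ h2]]; move: h1 h2; rewrite /= !in_itv /=; lra.
rewrite /= -!IH//; last by lra.
have clx : g false x <= c.
  by rewrite -[X in _ <= X](ib_1 gB false) (g_le gB)//; lra.
transitivity (J (preiter n `[0, g false x]) + J (preiter n `]c, g true x])); last first.
  by rewrite split_r; ring.
rewrite -J_disj; try by [exact: mP|exact: preiter_sub].
  apply: (@J_ae _ _ (preiter n [set c])); try by [exact: mP|exact: preiter_sub].
  - by apply: measurableU; exact: mP.
  - by rewrite subUset; split; exact: preiter_sub.
  - exact: preiter_null.
  apply/seteqP; split => t.
    move=> [[tI /= fuI] nuc]; have uI : 0 <= iter n f t <= 1.
      by apply: iter_f01; rewrite /= in_itv in tI.
    have uc : iter n f t != c by apply/eqP => uc; apply: nuc.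
    split => //; move: fuI; rewrite /= in_itv /= => /andP[_].
    rewrite f_below// => /orP[h|h]; [left|right]; split => //=; rewrite in_itv /=; lra.
  move=> [h nuc]; have tI : I t by case: h => -[].
  have uI : 0 <= iter n f t <= 1.
    by apply: iter_f01; move: tI; rewrite /= in_itv.
  have uc : iter n f t != c by apply/eqP => uc; apply: nuc.
  split => //; split => //=; rewrite in_itv /=; have /andP[-> _] := f01 uI.
  rewrite f_below//; case: h => -[_]; rewrite /= in_itv /= => /andP[h1 h2].
    by rewrite h2.
  by rewrite h1 h2 orbT.
apply/disj_setPS => t [[_ h1] [_ h2]]; move: h1 h2; rewrite /= !in_itv /=; lra.
Qed.

End density.

Variable p : R.
Hypothesis p01 : 0 < p < 1.
Hypothesis cumul_lim : forall rho0 F0 : R -> R,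
  (forall x, {for x, continuous rho0}) -> (forall x, 0 < rho0 x) -> F0 0 = 0 ->
  (forall x : R, 0 <= x <= 1 -> is_derive x 1 F0 (rho0 x)) ->
  forall x, 0 < x < 1 -> cumul c g F0 n x @[n --> \oo] --> p * F0 1.

(** Continuous functions are dense in L1; taking the absolute value and adding a
    small constant makes the approximation positive. *)
Lemma L1_approx (h : R -> R) e : (forall t, 0 <= h t) ->
  mu.-integrable I (EFin \o h) -> 0 < e -> exists rho0 : R -> R,
  [/\ forall x, {for x, continuous rho0}, forall x, 0 < rho0 x &
      \int[mu]_(t in I) `|h t - rho0 t| <= e].
Proof.
move=> h0 hint e0; have mI : measurable I by [].
have muI : mu I = 1%E.
  by rewrite lebesgue_measure_itv /= lte_fin ltr01 -EFinB subr0.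
have muIoo : (mu I < +oo)%E by rewrite muI ltry.
have [k [kc kint kcv]] := approximation_continuous_integrable mI muIoo hint.
have e2 : 0 < e / 2 by lra.
have fcv : fine (\int[mu]_(t in I) `|(h t - k n t)%:E|)%E @[n --> \oo] --> (0 : R).
  exact: fine_cvg kcv.
move/cvgrPdist_lt: fcv => /(_ _ e2)[N _ HN].
have {HN} hk := HN N (leqnn N); have {}kc := kc N; have {}kint := kint N.
rewrite /= sub0r normrN in hk; have {}hk := le_lt_trans (ler_norm _) hk.
move: (k N) kc kint hk => {kcv}k kc kint hk.
have dint : mu.-integrable I (EFin \o (fun t => `|h t - k t|)).
  exact: (integrable_norm (integrableB mI hint kint)).
exists (fun t => `|k t| + e / 2); split => [x|x|].
- apply: continuousD; last exact: cvg_cst.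
  by apply: (@continuous_comp _ _ _ k Num.norm); [exact: kc|exact: norm_continuous].
- by have := normr_ge0 (k x); lra.
have cint : mu.-integrable I (EFin \o (fun=> e / 2)).
  apply: continuous_compact_integrable; first exact: segment_compact.
  by apply: continuous_subspaceT => t; exact: cvg_cst.
have bint : mu.-integrable I (EFin \o (fun t => `|h t - k t| + e / 2)).
  exact: (integrableD mI dint cint).
apply: le_trans (_ : \int[mu]_(t in I) (`|h t - k t| + e / 2) <= _).
  apply: le_Rintegral => //.
    exact: (integrable_norm (integrableB mI hint
      (integrableD mI (integrable_norm kint) cint))).
  move=> t _; have := ler_dist_dist (h t) (k t); rewrite (ger0_norm (h0 t)) => hd.
  rewrite opprD addrA; apply: le_trans (ler_normB _ _) _.
  by rewrite (gtr0_norm e2) lerD2r.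
have Ie : \int[mu]_(t in I) (e / 2) = e / 2.
  transitivity (e / 2 * fine (mu I)); first exact: Rintegral_cst.
  by rewrite muI mulr1.
rewrite RintegralD// Ie.
have -> : \int[mu]_(t in I) `|h t - k t| =
    fine (\int[mu]_(t in I) `|(h t - k t)%:E|)%E by [].
lra.
Qed.

(** Taking images does not increase the L1 distance, so an approximation of the
    initial density is as good at all times. *)
Lemma law_cvg (lambda : probability (measurableTypeR R) R) (x : R) :
  lambda I = 1%E -> lambda `<< mu -> 0 < x < 1 ->
  fine (lambda (preiter n `[0, x])) @[n --> \oo] --> p.
Proof.
move=> l1 lmu xI.
pose h t := fine (Radon_Nikodym_SigmaFinite.f lambda mu t).
have hE : Radon_Nikodym_SigmaFinite.f lambda mu = EFin \o h.
  apply/funext => t; rewrite /h /= fineK//.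
  exact: (Radon_Nikodym_SigmaFinite.f_fin_num lmu).
have h0 t : 0 <= h t.
  exact/fine_ge0/(Radon_Nikodym_SigmaFinite.f_ge0 lmu).
have hint : mu.-integrable setT (EFin \o h).
  by rewrite -hE; exact: (Radon_Nikodym_SigmaFinite.f_integrable lmu).
have lamE A : measurable A -> fine (lambda A) = \int[mu]_(t in A) h t.
  move=> mA; rewrite (Radon_Nikodym_SigmaFinite.f_integral lmu mA).
  by rewrite hE.
have mI : measurable I by [].
have hI : mu.-integrable I (EFin \o h) by exact: integrableS hint.
apply/cvgrPdist_le => e e0.
have e8 : 0 < e / 8 by lra.
have [rho0 [rc rp rh]] := L1_approx h0 hI e8.
have [F0 F00 F0E] := primitive rc.
have F0d (t : R) : 0 <= t <= 1 -> is_derive t 1 F0 (rho0 t).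
  by move=> tI; apply: F0E; lra.
have rI : mu.-integrable I (EFin \o rho0).
  apply: continuous_compact_integrable; first exact: segment_compact.
  exact: continuous_subspaceT.
have dist A : measurable A -> A `<=` I ->
    `|fine (lambda A) - \int[mu]_(t in A) rho0 t| <= e / 8.
  move=> mA AI; rewrite lamE//.
  have hA := integrableS mI mA AI hI; have rA := integrableS mI mA AI rI.
  rewrite -RintegralB//; apply: le_trans (le_normr_Rintegral mA (integrableB mA hA rA)) _.
  apply: le_trans rh; apply: fine_le.
  - exact: (integrable_fin_num mA (integrable_norm (integrableB mA hA rA))).
  - exact: (integrable_fin_num mI (integrable_norm (integrableB mI hI rI))).
  - apply: ge0_subset_integral => //.
    exact: (measurable_int mu (integrable_norm (integrableB mI hI rI))).
have cI n t : 0 <= t <= 1 -> \int[mu]_(u in preiter n `[0, t]) rho0 u = cumul c g F0 n t.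
  exact: preiter_cumul rc F00 F0d n t.
have dI n t : 0 <= t <= 1 -> `|fine (lambda (preiter n `[0, t])) - cumul c g F0 n t| <= e / 8.
  move=> tI; rewrite -cI//; apply: dist; last exact: preiter_sub.
  exact: preiter_measurable.
have d1 : `|1 - F0 1| <= e / 8.
  have := dI 0%N 1; rewrite /= ler01 lexx => /(_ isT).
  have -> : preiter 0 `[0, 1] = I by rewrite /preiter setIid.
  by rewrite l1.
have /cvgrPdist_le/(_ _ e8) := cumul_lim rc rp F00 F0d xI.
apply: filterS => n hn.
have xI' : 0 <= x <= 1 by lra.
have := dI n x xI'; move: hn d1; rewrite !ler_norml.
have p0 : 0 <= p by have := p01; lra. have p1 : p <= 1 by have := p01; lra.
set L := fine _; set C := cumul _ _ _ _ _ => h1 h2 h3.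
have : - (e / 8) <= p * (1 - F0 1) <= e / 8.
  have [s|s] := leP 0 (1 - F0 1).
    have := mulr_ge0 p0 s; have := ler_piMl s p1; lra.
  have s' : 0 <= F0 1 - 1 by lra.
  have := mulr_ge0 p0 s'; have := ler_piMl s' p1; lra.
lra.
Qed.

End iterated_measure.

(** * Weak convergence to a measure carried by the end points *)

Section weak_convergence.
Variable R : realType.
Local Notation T := (measurableTypeR R).
Local Notation I := (`[0%R, 1%R]%classic : set T).
Local Notation mass m A := (fine (m (A : set T))).

Variables (m : nat -> {measure set T -> \bar R}) (p : R).
Hypothesis m1 : forall n, m n I = 1%E.
Hypothesis m_lim : forall x : R, 0 < x < 1 ->
  mass (m n) `[0%R, x]%classic @[n --> \oo] --> p.

Let mI : measurable I. Proof. exact: measurable_itv. Qed.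

Let m_fin n A : measurable A -> A `<=` I -> m n A \is a fin_num.
Proof.
move=> mA AI; rewrite ge0_fin_numE//; apply: le_lt_trans (ltry 1).
by rewrite -(m1 n); apply: le_measure; rewrite ?inE.
Qed.

Let mass_disj n A B : measurable A -> measurable B -> A `<=` I -> B `<=` I ->
  A `&` B = set0 -> mass (m n) (A `|` B) = mass (m n) A + mass (m n) B.
Proof.
move=> mA mB AI BI AB; rewrite measureU// fineD//; exact: m_fin.
Qed.

Lemma cont_integrable n (phi : R -> R) : {within `[0, 1], continuous phi} ->
  (m n).-integrable I (EFin \o phi).
Proof.
move=> cphi; apply: measurable_bounded_integrable => //.
- by rewrite m1 ltry.
- exact: measurable_realfun.subspace_continuous_measurable_fun.
- have /compact_bounded[M [_ mrt]] := continuous_compact cphi (@segment_compact R 0 1).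
  by exists M; split; rewrite ?num_real // => ? ? ? ?; exact: mrt.
Qed.

Lemma cont_integralE n (phi : R -> R) : {within `[0, 1], continuous phi} ->
  (\int[m n]_(t in I) (phi t)%:E)%E = (\int[m n]_(t in I) phi t)%:E.
Proof.
move=> cphi; rewrite /Rintegral fineK//.
exact: (integrable_fin_num mI (cont_integrable n cphi)).
Qed.

Let piece_le n A (phi : R -> R) K : measurable A -> A `<=` I ->
  {within `[0, 1], continuous phi} -> (forall t, A t -> phi t <= K) ->
  \int[m n]_(t in A) phi t <= K * mass (m n) A.
Proof.
move=> mA AI cphi phiK.
have iA := integrableS mI mA AI (cont_integrable n cphi).
rewrite -Rintegral_cst//; apply: le_Rintegral => //.
apply: measurable_bounded_integrable => //.
- by apply: le_lt_trans (ltry 1); rewrite -(m1 n); apply: le_measure; rewrite ?inE.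
- by exists `|K|; split; rewrite ?num_real// => M KM t _; exact: ltW.
Qed.

(** Splitting [0, 1] into neighbourhoods of the end points, on which the test
    function is nearly constant, and a middle part, whose mass vanishes. *)
Lemma weak_limsup (phi : R -> R) e : {within `[0, 1], continuous phi} -> 0 < e ->
  exists N, forall n, (N <= n)%N ->
    \int[m n]_(t in I) phi t <= p * phi 0 + (1 - p) * phi 1 + e.
Proof.
move=> cphi e0; have e2 : 0 < e / 2 by lra.
have [B0 _ HB] := EVT_max (@ler01 R) cphi; set B := phi B0 in HB.
have at_pt u : 0 <= u <= 1 -> exists2 d, 0 < d & forall t, 0 <= t <= 1 ->
    `|u - t| < d -> phi t <= phi u + e / 2.
  move=> uI; have uI' : `[0, 1]%classic u by rewrite /= in_itv.
  have /subspace_continuousP/(_ _ uI')/cvgrPdist_lt/(_ _ e2)[d /= d0 Hd] := cphi.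
  exists d => // t tI ut; have : `|phi u - phi t| < e / 2 by apply: (Hd t ut); rewrite /= in_itv.
  by rewrite ltr_norml; lra.
have [|d1 d10 H1] := at_pt 0; first by rewrite lexx ler01.
have [|d2 d20 H2] := at_pt 1; first by rewrite lexx ler01.
have [d3 [d30 d31 d32]] := pos_min d10 d20.
have third : 0 < 3^-1 :> R by rewrite invr_gt0.
have [d [d0 dd3 dt]] := pos_min d30 third.
have split_mass n (x : R) : 0 <= x < 1 -> mass (m n) `]x, 1]%classic =
    1 - mass (m n) `[0, x]%classic.
  move=> xI; have uI : I = `[0, x]%classic `|` `]x, 1]%classic.
    by apply/seteqP; split => t /=; rewrite !in_itv /=; [case: (leP t x); lra|lra].
  suff : mass (m n) I = mass (m n) `[0, x]%classic + mass (m n) `]x, 1]%classic.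
    rewrite m1 /= => h; apply: (@addrI _ (mass (m n) `[0, x]%classic)).
    by rewrite -h [RHS]addrC subrK.
  rewrite [in LHS]uI mass_disj//.
  - by move=> t /=; rewrite !in_itv /=; lra.
  - by move=> t /=; rewrite !in_itv /=; lra.
  - by apply/seteqP; split => t //= []; rewrite !in_itv /=; lra.
have half n : \int[m n]_(t in I) phi t <=
    (phi 0 + e / 2) * mass (m n) `[0, d / 2]%classic +
    (B * (mass (m n) `[0, 1 - d / 2]%classic - mass (m n) `[0, d / 2]%classic) +
    (phi 1 + e / 2) * (1 - mass (m n) `[0, 1 - d / 2]%classic)).
  have s1 : `[0, d / 2]%classic `<=` I by move=> t /=; rewrite !in_itv /=; lra.
  have s2 : `]d / 2, 1 - d / 2]%classic `<=` I by move=> t /=; rewrite !in_itv /=; lra.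
  have s3 : `]1 - d / 2, 1]%classic `<=` I by move=> t /=; rewrite !in_itv /=; lra.
  have s23 : `]d / 2, 1]%classic `<=` I by move=> t /=; rewrite !in_itv /=; lra.
  have e23 : `]d / 2, 1]%classic = `]d / 2, 1 - d / 2]%classic `|` `]1 - d / 2, 1]%classic.
    by apply/seteqP; split => t /=; rewrite !in_itv /=; [case: (leP t (1 - d / 2)); lra|lra].
  have e123 : I = `[0, d / 2]%classic `|` `]d / 2, 1]%classic.
    by apply/seteqP; split => t /=; rewrite !in_itv /=; [case: (leP t (d / 2)); lra|lra].
  have int A : measurable A -> A `<=` I -> (m n).-integrable A (EFin \o phi).
    by move=> mA AI; exact: integrableS (cont_integrable n cphi).
  rewrite e123 Rintegral_setU//; last 2 first.
  - by rewrite -e123; exact: cont_integrable.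
  - by apply/disj_setPS => t []; rewrite /= !in_itv /=; lra.
  rewrite e23 Rintegral_setU//; last 2 first.
  - by rewrite -e23; exact: int.
  - by apply/disj_setPS => t []; rewrite /= !in_itv /=; lra.
  apply: lerD; [|apply: lerD].
  - apply: piece_le => // t; rewrite /= in_itv /= => tI; apply: H1; first lra.
    by rewrite sub0r normrN ger0_norm; lra.
  - have -> : mass (m n) `[0, 1 - d / 2]%classic - mass (m n) `[0, d / 2]%classic =
        mass (m n) `]d / 2, 1 - d / 2]%classic.
      have := split_mass n (d / 2); have := split_mass n (1 - d / 2).
      rewrite e23 mass_disj//; first by lra.
      by apply/seteqP; split => t //= []; rewrite !in_itv /=; lra.
    by apply: piece_le => // t /s2 tI; exact: HB.
  - rewrite -split_mass; last by lra.
    apply: piece_le => // t; rewrite /= in_itv /= => tI; apply: H2; first lra.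
    by rewrite ger0_norm; lra.
have l1 := m_lim (_ : 0 < d / 2 < 1); have l2 := m_lim (_ : 0 < 1 - d / 2 < 1).
have {}l1 := l1 ltac:(lra); have {}l2 := l2 ltac:(lra).
set u1 := (fun n => _) in l1; set u2 := (fun n => _) in l2.
have : (fun n => (phi 0 + e / 2) * u1 n + (B * (u2 n - u1 n) +
    (phi 1 + e / 2) * (1 - u2 n))) @ \oo -->
    (phi 0 + e / 2) * p + (B * (p - p) + (phi 1 + e / 2) * (1 - p)).
  apply: cvgD; first by apply: cvgM => //; exact: cvg_cst.
  apply: cvgD; apply: cvgM; try exact: cvg_cst; first exact: cvgB.
  by apply: cvgB => //; exact: cvg_cst.
move=> /cvgrPdist_lt/(_ _ e2)[N _ HN]; exists N => n Nn.
apply: le_trans (half n) _; have := HN n Nn; rewrite /= ltr_norml /u1 /u2; lra.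
Qed.

(** The upper bound [weak_limsup] for the opposite function is a lower bound. *)
Lemma weak_lim (phi : R -> R) : {within `[0, 1], continuous phi} ->
  \int[m n]_(t in I) phi t @[n --> \oo] --> p * phi 0 + (1 - p) * phi 1.
Proof.
move=> cphi; have cphiN : {within `[0, 1], continuous (fun t => - phi t)}.
  by move=> t; apply: continuousN; exact: cphi.
have intN n : \int[m n]_(t in I) - phi t = - \int[m n]_(t in I) phi t.
  have i0 : (m n).-integrable I (EFin \o (fun=> 0 : R)).
    by apply: cont_integrable => t; exact: cvg_cst.
  under eq_Rintegral do rewrite -[- _]add0r.
  by rewrite RintegralB ?Rintegral_cst ?mul0r ?sub0r//; exact: cont_integrable.
apply/cvgrPdist_le => e e0.
have [N1 H1] := weak_limsup cphi e0; have [N2 H2] := weak_limsup cphiN e0.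
exists (maxn N1 N2) => // n; rewrite /= geq_max => /andP[n1 n2].
have := H1 n n1; have := H2 n n2; rewrite intN ler_norml; lra.
Qed.

End weak_convergence.

Section two_points.
Variables (R : realType) (p : R).
Hypothesis p01 : 0 <= p <= 1.
Local Notation T := (measurableTypeR R).

Let p_ge0 : 0 <= p. Proof. by case/andP: p01. Qed.
Let q_ge0 : 0 <= 1 - p. Proof. by rewrite subr_ge0; case/andP: p01. Qed.

Let two_point_measure : {measure set T -> \bar R} :=
  measure_add (mscale (NngNum p_ge0) (\d_(0 : T))) (mscale (NngNum q_ge0) (\d_(1 : T))).

Let two_point_massE : two_point_mass p = two_point_measure :> (set T -> \bar R).
Proof. by apply/funext => A; exact/esym/measure_addE. Qed.

(** The constant sequence equal to this measure satisfies the hypotheses of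
    [weak_lim]. *)
Lemma two_point_integral (phi : R -> R) : {within `[0, 1], continuous phi} ->
  (\int[two_point_mass p]_(t in `[0%R, 1%R]) (phi t)%:E)%E =
  (p * phi 0 + (1 - p) * phi 1)%:E.
Proof.
move=> cphi; rewrite two_point_massE.
have d0 (x : R) : 0 <= x -> \d_(0 : T) (`[0, x]%classic : set T) = 1%E :> \bar R.
  by move=> x0; rewrite diracE mem_set//= in_itv /= lexx.
have d1 (x : R) : x < 1 -> \d_(1 : T) (`[0, x]%classic : set T) = 0%E :> \bar R.
  by move=> x0; rewrite diracE memNset//= in_itv /= ler01 /= leNgt x0.
have m1 (n : nat) : two_point_measure (`[0, 1]%classic : set T) = 1%E.
  rewrite -two_point_massE /two_point_mass d0// diracE mem_set /=; last first.
    by rewrite in_itv /= lexx ler01.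
  by rewrite !mule1 -EFinD addrC subrK.
have m_lim (x : R) : 0 < x < 1 ->
    fine (two_point_measure (`[0, x]%classic : set T)) @[n --> \oo] --> p.
  move=> /andP[x0 x1]; rewrite -two_point_massE /two_point_mass d0 ?(ltW x0)//.
  by rewrite d1// mule1 mule0 adde0; exact: cvg_cst.
rewrite (cont_integralE (m := fun=> two_point_measure) m1 0%N cphi).
congr EFin; have := weak_lim (m := fun=> two_point_measure) m1 m_lim cphi.
move=> h; exact: (cvg_unique _ (cvg_cst _) h).
Qed.

End two_points.

(** * Convergence of the iterated images *)

Theorem theorem1p1 (R : realType) (alpha b1 b2 c : R) (f fl fr : R -> R)
  (halpha : 0 < alpha <= 1) (hb1 : 0 < b1) (hb2 : 0 < b2) (hc : 0 < c < 1)
  (f01 : set_fun `[0, 1] `[0, 1] f)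
  (f0 : f 0 = 0) (f1 : f 1 = 1)
  (df0 : derivable_within `[0, 1] f 0 /\ derive_within `[0, 1] f 0 = 1)
  (df1 : derivable_within `[0, 1] f 1 /\ derive_within `[0, 1] f 1 = 1)
  (* [fl] and [fr] are the C^2 extensions of the two branches *)
  (f_diffeo_l : C2_diffeo `]0, c[ `]0, 1[ f)
  (f_diffeo_r : C2_diffeo `]c, 1[ `]0, 1[ f)
  (fl_ext : [/\ C2_on `[0, c] fl, {in `]0, c[, fl =1 f}
              & fl @` `[0, c] = `[0, 1]%classic])
  (fr_ext : [/\ C2_on `[c, 1] fr, {in `]c, 1[, fr =1 f}
              & fr @` `[c, 1] = `[0, 1]%classic])
  (df_gt1 : forall x : R, 0 < x < 1 -> x != c -> 1 < derive1 f x)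
  (dfl_gt1 : 1 < derive_within `[0, c] fl c)
  (dfr_gt1 : 1 < derive_within `[c, 1] fr c)
  (f_convex : exists2 e : R, 0 < e < 1 & convex_function `[0, e] f)
  (f_concave : exists2 e : R, 0 < e < 1 &
     convex_function `[1 - e, 1] (fun x => - f x))
  (f_asymp0 : (f x - x) / (b1 * x `^ (1 + alpha^-1)) @[x --> 0^'+] --> (1 : R))
  (f_asymp1 : (x - f x) / (b2 * (1 - x) `^ (1 + alpha^-1)) @[x --> 1^'-] --> (1 : R)) :
  exists2 p : R, 0 < p < 1 &
    forall lambda : probability (measurableTypeR R) R,
      lambda `[0, 1]%classic = 1%E ->
      lambda `<< lebesgue_measure ->
      weak_star_cvg01 (fun n => pushforward01 lambda (iter n f))
        (two_point_mass p).
Proof.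
have [fl2 flE fl_img] := fl_ext; have [fr2 frE fr_img] := fr_ext.
have [D gB] := f_inv_branches hc fl2 fr2 flE frE fl_img fr_img df_gt1.
pose k := entry_ratio alpha b1 b2 c fl fr.
have k0 : 0 < k by apply: (@entry_ratio_gt0 _ _ _ _ _ f).
pose p := k / (1 + k).
have k1 : 0 < 1 + k by rewrite addr_gt0.
have p01 : 0 < p < 1 by rewrite /p divr_gt0//= ltr_pdivrMr// mul1r ltrDr.
exists p => // lambda l1 lmu phi cphi.
have f01' t : 0 <= t <= 1 -> 0 <= f t <= 1.
  move=> tI; have tI' : `[0, 1]%classic t by rewrite /= in_itv.
  by have := f01 t tI'; rewrite /= in_itv.
have f_meas := f_measurable hc fl2 fr2 flE frE fl_img fr_img df_gt1 f0 f1.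
have f_bel := f_below hc fl2 fr2 flE frE fl_img fr_img df_gt1 f0 f1.
have f_fib := f_fiber hc fl2 fr2 flE frE fl_img fr_img df_gt1 f0 f1.
have lim := cumul_iterates_cvg halpha hb1 hb2 hc fl2 fr2 flE frE fl_img fr_img df_gt1
  f_asymp0 f_asymp1.
have law := law_cvg gB f01' f_meas f_bel f_fib p01 lim l1 lmu.
pose I := `[0, 1]%classic : set (measurableTypeR R).
have mI : measurable I by exact: measurable_itv.
pose h n : measurableTypeR R -> measurableTypeR R := iter n f \_ I.
have mh n : measurable_fun setT (h n).
  by apply/(measurable_restrictT _ mI); exact: (iter_f_meas f01' f_meas n).
(* An image is a measure only if the map is measurable, which [m'] takes as an
   argument. *)
pose m' n : {measure set (measurableTypeR R) -> \bar R} :=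
  pushforward (mrestr lambda (measurable_itv `[0, 1])) (h n).
pose m := m' mh.
have mE n : pushforward01 lambda (iter n f) = m n.
  apply/funext => A; rewrite /m /m' /= /pushforward01 /pushforward /mrestr.
  congr (lambda _); apply/seteqP; split => t [/= At tI]; split => //=.
    by rewrite /h patchT// inE.
  by move: At; rewrite /h patchT// inE.
have m1 n : m n I = 1%E.
  rewrite -mE /pushforward01 /pushforward /mrestr -[RHS]l1; congr (lambda _).
  apply/seteqP; split => [t []//|t tI]; split => //.
  move: tI; rewrite /I /= !in_itv /=; exact: (iter_f01 f01').
have m_lim x : 0 < x < 1 -> fine (m n (`[0, x]%classic : set (measurableTypeR R)))
    @[n --> \oo] --> p.
  move=> /law; rewrite (_ : (fun n => fine (lambda _)) =
    (fun n => fine (m n (`[0, x]%classic : set (measurableTypeR R)))))//.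
  by apply/funext => n; rewrite -mE /preiter setIC.
under eq_fun do rewrite mE (cont_integralE m1 _ cphi).
rewrite two_point_integral//; last by lra.
by apply: cvg_EFin; [exact: nearW|exact: (weak_lim m1 m_lim cphi)].
Qed.
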